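(* For every positive integer $K$ there is a constant $C_K>0$, depending only on $K$, such that the following holds for every constant $0<c\le 1$, every positive integer $N$, and every real $z$ with $1-\frac1N\le z\le 1$. Let $U$ be a Haar-distributed random matrix in $U(N)$, with characteristic polynomial $P(z)=\prod_{j=1}^N (z-z_j)$, where $z_j=e^{i\theta_j}$ and $-\pi<\theta_j\le\pi$. Whenever $z\neq z_j$ for all $j$, $$\frac{P'}{P}(z)=\sum_{|\theta_j|<\frac cN}\frac{1}{z-z_j}+\mathcal E,$$ where the error term $$\mathcal E=\sum_{|\theta_j|\ge \frac cN}\frac{1}{z-z_j}$$ satisfies $$\mathbb E\,|\mathcal E|^{2K}\le C_K\left(\frac Nc\right)^{2K}.$$
   Context: $U(N)$ is the group of $N\times N$ unitary matrices equipped with its Haar probability measure, and $\mathbb E$ denotes expectation over $U\in U(N)$ with respect to this measure. For $U\in U(N)$, $P=P_U$ is its characteristic polynomial, $P(z)=\prod_{j=1}^N(z-z_j)$, where $z_1,\dots,z_N$ are the eigenvalues of $U$ with multiplicity, written $z_j=e^{i\theta_j}$ with $-\pi<\theta_j\le\pi$. $\frac{P'}{P}(z)=P'(z)/P(z)$ is the logarithmic derivative. Sums such as $\sum_{|\theta_j|<c/N}$ run over the indices $j\in\{1,\dots,N\}$ satisfying the stated condition. *)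

(* Defs.v *)
From HB Require Import structures.
From mathcomp Require Import all_boot all_order all_algebra.
From mathcomp Require Import all_classical all_reals all_analysis.
From mathcomp Require Import complex.

Set Implicit Arguments.
Unset Strict Implicit.
Unset Printing Implicit Defensive.

Import Order.TTheory GRing.Theory Num.Theory numFieldNormedType.Exports.

Local Open Scope classical_set_scope.
Local Open Scope ring_scope.
Local Open Scope complex_scope.

(* [R[i]] by itself carries no topology; seen as a [numFieldType] it gets the
   norm topology, and matrices over it the product topology. *)
Definition cplx (R : realType) : numClosedFieldType := R[i].

Definition unitary_set (R : realType) (N : nat) : set 'M[cplx R]_N :=
  [set U : 'M[cplx R]_N | U \is unitarymx].

(* [set_type] carries the topology induced by the ambient space of matrices. *)
Definition unitary (R : realType) (N : nat) : Type :=
  set_type (@unitary_set R N).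

HB.instance Definition _ (R : realType) (N : nat) :=
  Topological.copy (unitary R N) (set_type (@unitary_set R N)).

Section unitary_group.
Context (R : realType) (N : nat).
Implicit Types U V : unitary R N.

Definition umx U : 'M[R[i]]_N := \val U.

Lemma umx_unitary U : (umx U : 'M[cplx R]_N) \is unitarymx.
Proof. by case: U => M h; exact: (set_mem h). Qed.

Lemma umul_subproof U V :
  ((umx U : 'M[cplx R]_N) *m umx V) \in @unitary_set R N.
Proof. by apply/mem_set/mul_unitarymx; exact: umx_unitary. Qed.

Definition umul U V : unitary R N :=
  exist (fun M => M \in @unitary_set R N) _ (umul_subproof U V).

Lemma uone_subproof : (1%:M : 'M[cplx R]_N) \in @unitary_set R N.
Proof.
by apply/mem_set; apply/unitarymxP; rewrite trmx1 map_mx1 mulmx1.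
Qed.

Definition uone : unitary R N :=
  exist (fun M => M \in @unitary_set R N) _ uone_subproof.

HB.instance Definition _ := isPointed.Build (unitary R N) uone.

End unitary_group.

Definition unitary_borel (R : realType) (N : nat) :=
  g_sigma_algebraType (@open (unitary R N)).

(* The Haar probability measure: left invariance characterises it, since [U(N)]
   is a compact group with countable basis. *)
Definition is_haar (R : realType) (N : nat)
    (mu : probability (unitary_borel R N) R) : Prop :=
  forall (V : unitary R N) (A : set (unitary_borel R N)),
    measurable A -> mu (umul V @^-1` A) = mu A.

Definition expi (R : realType) (t : R) : R[i] := cos t +i* sin t.

Lemma expi_surj (R : realType) (w : R[i]) :
  `|w| = 1 -> exists2 t : R, - pi < t <= pi & expi t = w.
Proof.
case: w => a b /(congr1 (fun x => x ^+ 2)).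
rewrite -add_Re2_Im2 expr1n /= => -[ab1].
have a1 : -1 <= a <= 1.
  rewrite -ler_norml -(@expr_le1 _ 2)// real_normK ?num_real// -ab1.
  by rewrite lerDl sqr_ge0.
have sq : Num.sqrt (1 - a ^+ 2) = `|b|.
  by rewrite -ab1 addrAC subrr add0r sqrtr_sqr.
have [b0|b0] := leP 0 b.
  exists (acos a); last by rewrite /expi acosK ?in_itv//= sin_acos// sq ger0_norm.
  rewrite (lt_le_trans _ (acos_ge0 a1)) ?oppr_lt0 ?pi_gt0//=.
  by rewrite acos_lepi.
exists (- acos a).
  rewrite (le_trans _ (pi_ge0 _)) ?andbT ?oppr_le0 ?acos_ge0// ltrN2.
  rewrite acos_ltpi//; case/andP: a1 => a1 ->; rewrite andbT lt_neqAle a1 andbT.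
  apply: contraTneq b0 => a1'; move: ab1; rewrite -a1' sqrrN expr1n.
  move/eqP; rewrite -[X in _ == X]addr0 (inj_eq (addrI _)) sqrf_eq0.
  by move=> /eqP->; rewrite ltxx.
by rewrite /expi cosN sinN acosK ?in_itv//= sin_acos// sq ltr0_norm// opprK.
Qed.

(* The eigenangles, listed with multiplicity: [expi (theta j)], [j < N], are the
   roots of the characteristic polynomial. *)
Definition is_eigenangles (R : realType) (N : nat) (U : 'M[R[i]]_N)
    (theta : 'I_N -> R) : Prop :=
  (forall j, - pi < theta j <= pi) /\
  char_poly U = \prod_(j < N) ('X - (expi (theta j))%:P).

(* The eigenangles of [U] in some order; the default value is never used when
   [U] is unitary, see [eigenangleP]. *)
Definition eigenangle (R : realType) (N : nat) (U : 'M[R[i]]_N) : 'I_N -> R :=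
  xget (fun=> 0) [set theta | is_eigenangles U theta].

Section eigenvalue_norm.
Local Open Scope sesquilinear_scope.

Lemma unitary_eigenvalue_norm (C : numClosedFieldType) (N : nat) (U : 'M[C]_N)
  (w : C) : U \is unitarymx -> eigenvalue U w -> `|w| = 1.
Proof.
move=> /unitarymxP UU /eigenvalueP[v vU v0].
have : (v *m U) *m (v *m U) ^t* = v *m v ^t*.
  by rewrite trmx_mul map_mxM mulmxA -(mulmxA v) UU mulmx1.
rewrite vU linearZ/= map_mxZ -scalemxAl -scalemxAr scalerA.
move/(congr1 (fun M : 'M[C]_1 => M 0 0)); rewrite mxE -dotmxE -normCK => wv.
have vv : dotmx v v != 0 by rewrite gt_eqF// dotmx_is_dotmx.
apply/eqP; rewrite -(@eqrXn2 _ 2)// expr1n; apply/eqP.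
by apply: (mulIf vv); rewrite wv mul1r.
Qed.

End eigenvalue_norm.

Lemma eigenangleP (R : realType) (N : nat) (U : unitary R N) :
  is_eigenangles (umx U) (eigenangle (umx U)).
Proof.
rewrite /eigenangle; case: xgetP => [theta -> //|/= none]; exfalso.
have [r] := closed_field_poly_normal (char_poly (umx U)).
rewrite (monicP (char_poly_monic _)) scale1r => Ur.
have szr : size r = N.
  apply: succn_inj; rewrite -[RHS](size_char_poly (umx U)) Ur.
  by rewrite size_prod_XsubC.
have ang (j : 'I_N) : exists t : R, - pi < t <= pi /\ expi t = r`_j.
  have [|t ? ?] := @expi_surj R r`_j; last by exists t.
  apply: (unitary_eigenvalue_norm (umx_unitary U)).
  rewrite eigenvalue_root_char Ur root_prod_XsubC mem_nth// szr.
  exact: ltn_ord.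
have /choice[theta thetaP] := ang.
apply: (none theta); split=> [j|]; first by have [] := thetaP j.
rewrite Ur (big_nth 0) big_mkord szr; apply: eq_bigr => j _.
by have [_ ->] := thetaP j.
Qed.

Definition eigval (R : realType) (N : nat) (U : 'M[R[i]]_N) (j : 'I_N) : R[i] :=
  expi (eigenangle U j).

Definition logderiv (R : realType) (N : nat) (U : 'M[R[i]]_N) (z : R[i]) :
    R[i] :=
  (char_poly U)^`().[z] / (char_poly U).[z].

Definition near_sum (R : realType) (N : nat) (U : 'M[R[i]]_N) (c z : R) : R[i] :=
  \sum_(j < N | `|eigenangle U j| < c / N%:R) 1 / (z%:C - eigval U j).

Definition error_term (R : realType) (N : nat) (U : 'M[R[i]]_N) (c z : R) :
    R[i] :=
  \sum_(j < N | c / N%:R <= `|eigenangle U j|) 1 / (z%:C - eigval U j).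

(* Main.v *)
Require Import Defs.
From mathcomp Require Import all_boot all_order all_algebra.
From mathcomp Require Import all_classical all_reals all_analysis.
From mathcomp Require Import complex.
From mathcomp Require Import measurable_realfun ring lra zify.

Import Order.TTheory GRing.Theory Num.Theory numFieldNormedType.Exports.
Local Open Scope ring_scope.

(** Put p_k = Tr U^k. Differentiating Haar invariance along one-parameter families
    of left translations gives the Schwinger-Dyson (loop) equations for the joint
    moments E[prod p_k * prod conj p_l]. The moments of independent complex
    Gaussians of variance k satisfy the same equations, and these have a unique
    solution as long as the indices k, and the indices l, each add up to at most
    N, because the cut-and-join terms then have total weight less than N. Hence
    E|sum_(k <= M) a_k p_k|^(2K) <= K! M^(2K) whenever |a_k| <= 1 and K M <= N.

    Take M about N/K. Replacing 1/(z - w) by the Cesaro mean of degree M of its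
    Fourier series changes it, for w = exp(i theta), by at most a constant times
    (N/c)/M times a positive trigonometric polynomial of degree less than M, also
    when the term is cut off to 0 for |theta| < c/N. So |error| is at most a
    constant times (N + |X| + |Y|)/c, where X and Y are linear combinations of
    p_1, ..., p_M as above. *)

Set Implicit Arguments.
Unset Strict Implicit.
Unset Printing Implicit Defensive.

(** * Gaussian solution of the loop equations *)

(** The degree budget fixes every scale. The Gaussian formula stops at total index N, and the 2K-th
    power of a trace polynomial of degree M expands into lists of total index up to K M; so M is at
    most N/K and the estimates live at resolution 1/M. With d = |1 - w|, a term that is not cut off
    is O(N/c) where d <= 1/M, and its Cesaro error is O(1/(M d^2)) where d > 1/M. The majorant must
    therefore be at least of order M/(1 + M d)^2 everywhere and still have mean 1, so that its sum
    over the eigenvalues is N plus a trace polynomial. The Fejer kernel has this profile except for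
    its zeros, whence the smoothing. The cutoff acts only where d <= c/N <= 1/M, a region where the
    majorant already absorbs terms of size N/c. The numbering of the eigenangles is a choice; the
    functions whose expectation is computed are polynomials in the matrix entries and their
    conjugates, and the error is only compared with them pointwise. *)

Section RemovalSum.
Variable C : numClosedFieldType.
Implicit Types (s la mu : seq nat) (phi psi : nat -> seq nat -> C).

(** Removal goes by position, so that equal entries count with multiplicity, as both Wick pairings
    and the Leibniz rule require. *)
Definition rmsum s phi : C :=
  \sum_(i < size s) phi (nth 0%N s i) (take i s ++ drop i.+1 s).

Lemma rmsum_nil phi : rmsum [::] phi = 0.
Proof. by rewrite /rmsum big_ord0. Qed.

Lemma rmsum_cons k s phi :
  rmsum (k :: s) phi = phi k s + rmsum s (fun l s' => phi l (k :: s')).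
Proof. by rewrite /rmsum big_ord_recl /= drop0. Qed.

Lemma perm_rm s i : (i < size s)%N ->
  perm_eq (nth 0%N s i :: (take i s ++ drop i.+1 s)) s.
Proof.
move=> si; rewrite -{4}(cat_take_drop i s) (drop_nth 0%N si).
by rewrite -cat1s perm_catCA.
Qed.

Lemma eq_rmsum s phi psi :
  (forall l s', perm_eq (l :: s') s -> phi l s' = psi l s') ->
  rmsum s phi = rmsum s psi.
Proof. by move=> e; apply: eq_bigr => i _; apply/e/perm_rm. Qed.

Lemma mulr_rmsumr a s phi : a * rmsum s phi = rmsum s (fun l s' => a * phi l s').
Proof. exact: mulr_sumr. Qed.

Lemma rmsumB s phi psi :
  rmsum s phi - rmsum s psi = rmsum s (fun l s' => phi l s' - psi l s').
Proof. by rewrite /rmsum big_split/= sumrN. Qed.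

Lemma rmsumD s phi psi :
  rmsum s phi + rmsum s psi = rmsum s (fun l s' => phi l s' + psi l s').
Proof. by rewrite /rmsum big_split. Qed.

Lemma exchange_rmsum s t (phi : nat -> seq nat -> nat -> seq nat -> C) :
  rmsum s (fun l s' => rmsum t (fun m t' => phi l s' m t')) =
  rmsum t (fun m t' => rmsum s (fun l s' => phi l s' m t')).
Proof. exact: exchange_big. Qed.

Lemma sumn_nth s : sumn s = (\sum_(i < size s) nth 0%N s i)%N.
Proof. by rewrite sumnE (big_nth 0%N) big_mkord. Qed.

Lemma ler_norm_rmsum s (F : nat -> seq nat -> C) (B : C) :
  (forall l s', perm_eq (l :: s') s -> `|F l s'| <= B) ->
  `|rmsum s (fun l s' => l%:R * F l s')| <= (sumn s)%:R * B.
Proof.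
move=> FB; apply: le_trans (ler_norm_sum _ _ _) _.
rewrite sumn_nth natr_sum mulr_suml; apply: ler_sum => i _.
by rewrite normrM ger0_norm ?ler0n// ler_wpM2l ?ler0n// FB// perm_rm.
Qed.

(* [E (\prod_(k <- la) z_k * \prod_(k <- mu) conj z_k)] for independent centred
   complex Gaussians [z_k] of variance [k] (Wick's formula). *)
Fixpoint wick la mu : C :=
  if la is k :: la' then
    k%:R * rmsum mu (fun l mu' => (l == k)%:R * wick la' mu')
  else (nilp mu)%:R.

Lemma wick_cons k la mu : wick (k :: la) mu =
  k%:R * rmsum mu (fun l mu' => (l == k)%:R * wick la mu').
Proof. by []. Qed.

(** [wick] recurses on its first list; the expansion along the second one follows by exchanging two
    removals, one from each list. *)
Lemma wick_consr k la mu : wick la (k :: mu) =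
  k%:R * rmsum la (fun l la' => (l == k)%:R * wick la' mu).
Proof.
elim: la mu => [|j la IH] mu; first by rewrite rmsum_nil mulr0.
rewrite !rmsum_cons wick_cons rmsum_cons !mulrDr; congr (_ + _).
  by have [->//|_] := eqVneq k j; rewrite !mul0r !mulr0.
under eq_rmsum do rewrite IH mulrCA mulr_rmsumr.
rewrite -mulr_rmsumr mulrCA; congr (_ * _).
under [RHS]eq_rmsum do rewrite wick_cons mulrCA mulr_rmsumr.
rewrite -mulr_rmsumr; congr (_ * _).
rewrite exchange_rmsum; apply: eq_rmsum => l la' _.
by apply: eq_rmsum => m mu' _; rewrite mulrCA.
Qed.

Lemma wick_ge0 la mu : 0 <= wick la mu.
Proof.
elim: la mu => [|k la IH] mu; first by rewrite ler0n.
by rewrite mulr_ge0// sumr_ge0// => i _; rewrite mulr_ge0.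
Qed.

Lemma wick_sym la mu : wick la mu = wick mu la.
Proof.
elim: la mu => [|k la IH] mu.
  by case: mu => // k mu; rewrite wick_consr wick_cons !rmsum_nil.
rewrite wick_consr wick_cons; congr (_ * _).
by apply: eq_rmsum => l mu' _; rewrite IH.
Qed.

(* The Schwinger-Dyson equations satisfied by the joint moments
   [E (\prod_(k <- la) Tr U^k * \prod_(k <- mu) conj (Tr U^k))]. *)
Definition loop_eq N (f : seq nat -> seq nat -> C) := forall k la mu,
  (0 < k)%N -> all (ltn 0) la -> all (ltn 0) mu ->
  N%:R * f (k :: la) mu + \sum_(1 <= l < k) f [:: l, (k - l)%N & la] mu
  + rmsum la (fun m la' => m%:R * f ((k + m)%N :: la') mu) =
  rmsum mu (fun l mu' => l%:R *
    (if (l < k)%N then f ((k - l)%N :: la) mu'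
     else if (k < l)%N then f la ((l - k)%N :: mu') else N%:R * f la mu')).

(** The terms on the left answer one by one to the cases on the right: the term with factor N to l =
    k, the splittings of k to l < k, and the mergers k + m to l > k, where both sides select the
    pairs with l = k + m. *)
Lemma loop_eq_wick N : loop_eq N wick.
Proof.
move=> k la mu k0 la0 mu0.
have -> : \sum_(1 <= l < k) wick [:: l, (k - l)%N & la] mu =
  rmsum mu (fun l mu' => (l < k)%N%:R * (l%:R * wick ((k - l)%N :: la) mu')).
  under eq_bigr do rewrite wick_cons mulr_rmsumr.
  rewrite exchange_big; apply: eq_bigr => i _ /=.
  set l := nth _ _ _; set mu' := _ ++ _.
  have l0 : (0 < l)%N by apply: (allP mu0); rewrite mem_nth.
  have [lk|kl] := ltnP l k.
    rewrite (bigD1_seq l) ?mem_index_iota ?iota_uniq ?l0//=.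
    rewrite big1 ?addr0 ?eqxx ?mul1r// => j jl.
    by rewrite [l == j]eq_sym (negbTE jl) mul0r mulr0.
  rewrite mul0r big_nat big1// => j /andP[_ jk].
  by rewrite gtn_eqF ?(leq_trans jk)// mul0r mulr0.
have -> : rmsum la (fun m la' => m%:R * wick ((k + m)%N :: la') mu) =
  rmsum mu (fun l mu' => (k < l)%N%:R * (l%:R * wick la ((l - k)%N :: mu'))).
  under eq_rmsum do rewrite wick_cons mulrA mulr_rmsumr.
  rewrite exchange_rmsum; apply: eq_rmsum => l mu' _.
  rewrite wick_consr !mulrA mulr_rmsumr; apply: eq_rmsum => m la' la'la.
  have m0 : (0 < m)%N.
    by apply: (allP la0); rewrite -(perm_mem la'la) mem_head.
  have [->|lkm] := eqVneq l (k + m)%N.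
    rewrite (_ : k + m - k = m)%N ?eqxx; last by lia.
    by rewrite (_ : k < k + m)%N ?mul1r; [ring | lia].
  rewrite !mul0r mulr0; case: ltnP => kl; rewrite ?mul0r// mul1r.
  by rewrite (_ : (_ == _) = false) ?mul0r ?mulr0//; apply/negbTE; lia.
rewrite wick_cons mulrA mulr_rmsumr !rmsumD; apply: eq_rmsum => l mu' _.
by case: ltngtP => [||->]; rewrite ?mul1r ?mul0r ?mulr0 ?addr0 ?add0r
  ?[_ * k%:R]mulrC ?mulrA//.
Qed.

Lemma ex_max_norm (T : eqType) (s : seq T) (F : T -> C) x0 : x0 \in s ->
  exists2 x, x \in s & forall y, y \in s -> `|F y| <= `|F x|.
Proof.
elim: s x0 => // a [|b s] IH x0 _.
  by exists a; rewrite ?mem_head// => y; rewrite inE => /eqP->.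
have [x xs xmax] := IH b (mem_head _ _).
have /orP[ax|xa] := real_leVge (normr_real (F a)) (normr_real (F x)).
  by exists x => [|y]; rewrite inE ?xs ?orbT// => /predU1P[->//|/xmax].
exists a => [|y]; rewrite inE ?eqxx// => /predU1P[->//|/xmax ys].
exact: le_trans ys xa.
Qed.

Lemma size_le_sumn s : all (ltn 0) s -> (size s <= sumn s)%N.
Proof. by elim: s => //= k s IH /andP[k0 /IH]; lia. Qed.

(** This is the finite set over which the maximum in the uniqueness proof is taken. A composition of
    n has at most n parts, each at most n, so it is an n-tuple once padded with zeros. *)
Lemma finite_compositions n : exists cs : seq (seq nat),
  forall s, (s \in cs) = (all (ltn 0) s && (sumn s == n)).
Proof.
pose P s := all (ltn 0) s && (sumn s == n).
(* [h] deletes the zero padding. *)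
pose h (t : n.-tuple 'I_n.+1) := [seq k <- [seq val i | i <- t] | (0 < k)%N].
exists [seq s <- [seq h t | t <- enum {: n.-tuple 'I_n.+1}] | P s] => s.
rewrite mem_filter -/(P s); case: (boolP (P s)) => //= /andP[s0 /eqP sn].
have sz : (size s <= n)%N by rewrite -sn size_le_sumn.
pose t := [tuple (inord (nth 0%N s i) : 'I_n.+1) | i < n].
apply/mapP; exists t; first by rewrite mem_enum.
rewrite /h; have -> : [seq val i | i <- t] = s ++ nseq (n - size s) 0%N.
  apply: (@eq_from_nth _ 0%N).
    by rewrite size_map size_tuple size_cat size_nseq subnKC.
  rewrite size_map size_tuple => j jN.
  rewrite (nth_map ord0) ?size_tuple// -[j]/(val (Ordinal jN)) -tnth_nth tnth_mktuple /=.
  rewrite nth_cat nth_nseq if_same inordK; last first.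
    rewrite ltnS; have [is_|] := ltnP j (size s); last by move=> /(nth_default _)->.
    by rewrite -sn -(perm_sumn (perm_rm is_)) /= leq_addr.
  by case: ltnP => // /(nth_default _).
rewrite filter_cat (_ : [seq k <- nseq _ _ | _] = [::]) ?cats0.
  by apply/esym/all_filterP.
by elim: (n - size s)%N.
Qed.

(** Induction on the total degree, combined with a maximum principle. The right side of the equation
    has smaller total degree, so f and h agree there. The left side keeps [sumn la]; at the list k
    :: nu that maximises m = |f - h| for this sum, it gives N m <= (k - 1 + sumn nu) m, and k - 1 +
    sumn nu = sumn la - 1 < N forces m = 0. *)
Lemma loop_eq_unique N (f h : seq nat -> seq nat -> C) :
  loop_eq N f -> loop_eq N h ->
  f [::] [::] = h [::] [::] ->
  (forall la mu, f la mu = (f mu la)^*) -> (forall la mu, h la mu = (h mu la)^*) ->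
  forall la mu, all (ltn 0) la -> all (ltn 0) mu ->
  (sumn la <= N)%N -> (sumn mu <= N)%N -> f la mu = h la mu.
Proof.
move=> lf lh fh00 fC hC la mu la0 mu0 laN muN.
have [d] := ubnP (sumn la + sumn mu).
elim: d => // d IH in la mu la0 mu0 laN muN *; rewrite ltnS => lamud.
(* Conjugation exchanges the two lists, so a nonempty one may be put first. *)
wlog : la mu la0 mu0 laN muN lamud / la != [::].
  move=> W; have [la_|] := eqVneq la [::]; last exact: W.
  have [mu_|mun] := eqVneq mu [::]; first by rewrite la_ mu_.
  by rewrite fC hC W// addnC.
move=> lan.
have [cs csP] := finite_compositions (sumn la).
have lacs : la \in cs by rewrite csP la0 eqxx.
have [[|k nu]] := ex_max_norm (fun s => f s mu - h s mu) lacs.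
  by rewrite csP => /= /eqP/esym;
    case: la la0 lan {laN lamud lacs csP} => //= k la /andP[]; lia.
rewrite csP => /andP[/= /andP[k0 nu0] /eqP sn] maxl.
set m := `|_ - _| in maxl.
suff m0 : m <= 0.
  apply/eqP; rewrite -subr_eq0 -normr_le0; exact: le_trans (maxl _ lacs) m0.
have := lf k nu mu k0 nu0 mu0; have := lh k nu mu k0 nu0 mu0.
set rh := rmsum mu _ => eh; set rf := rmsum mu _ => ef.
have rfh : rf = rh.
  apply: eq_rmsum => l mu' pl.
  have := perm_sumn pl; have := perm_all (ltn 0) pl.
  rewrite mu0 /= => /andP[l0 mu'0] smu.
  case: ltngtP => kl; congr (_ * _); last 1 [congr (_ * _)];
    apply: IH => //=; rewrite ?mu'0 ?nu0 ?subn_gt0 ?kl//; lia.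
have {ef eh rfh} : N%:R * (f (k :: nu) mu - h (k :: nu) mu) =
  - (\sum_(1 <= l < k) (f [:: l, (k - l)%N & nu] mu - h [:: l, (k - l)%N & nu] mu)
   + rmsum nu (fun m la' => m%:R * (f ((k + m)%N :: la') mu - h ((k + m)%N :: la') mu))).
  under [rmsum nu _]eq_rmsum do rewrite mulrBr.
  rewrite -rmsumB sumrB; apply/eqP; rewrite eq_sym -subr_eq0 -oppr_eq0 opprB.
  by apply/eqP; move: ef; rewrite rfh -eh => /eqP; rewrite -subr_eq0 => /eqP {3}<-; ring.
move=> /(congr1 Num.norm); rewrite normrM normrN ger0_norm ?ler0n// -/m => em.
(* There are k - 1 splittings, and the mergers carry total weight [sumn nu]. *)
have : N%:R * m <= (k.-1)%:R * m + (sumn nu)%:R * m.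
  rewrite em; apply: le_trans (ler_normD _ _) _; apply: lerD; last first.
    apply: ler_norm_rmsum => l s' pl; apply: maxl.
    have := perm_sumn pl; have := perm_all (ltn 0) pl.
    by rewrite nu0 csP /= => /andP[l0 ->] ?; lia.
  apply: le_trans (ler_norm_sum _ _ _) _.
  rewrite -(subn1 k) mulr_natl -sumr_const_nat big_nat [leRHS]big_nat.
  apply: ler_sum => l /andP[l1 lk]; apply: maxl.
  by rewrite csP /= nu0; lia.
rewrite -mulrDl -natrD -subr_le0 -mulrBl.
rewrite -natrB; last by lia.
rewrite pmulr_rle0// ltr0n; lia.
Qed.

(** * Sums over K-tuples of indices and the Gaussian moment of order 2K *)

Fixpoint seqsum M K (F : seq nat -> C) : C :=
  if K is K'.+1 then \sum_(1 <= k < M.+1) seqsum M K' (fun s => F (k :: s))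
  else F [::].

Lemma seqsumS M K (F : seq nat -> C) :
  seqsum M K.+1 F = \sum_(1 <= k < M.+1) seqsum M K (fun s => F (k :: s)).
Proof. by []. Qed.

Lemma eq_seqsum M K (F G : seq nat -> C) :
  (forall s, size s = K -> all (fun k => 0 < k <= M)%N s -> F s = G s) ->
  seqsum M K F = seqsum M K G.
Proof.
elim: K F G => [|K IH] F G FG /=; first exact: FG.
rewrite big_nat [RHS]big_nat; apply: eq_bigr => k kM; apply: IH => s sK sM.
by apply: FG; rewrite /= ?sK// sM andbT.
Qed.

Lemma ler_norm_seqsum M K (F : seq nat -> C) :
  `|seqsum M K F| <= seqsum M K (fun s => `|F s|).
Proof.
elim: K F => [|K IH] F //=; apply: le_trans (ler_norm_sum _ _ _) _.
exact: ler_sum.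
Qed.

Lemma ler_seqsum M K (F G : seq nat -> C) :
  (forall s, size s = K -> all (fun k => 0 < k <= M)%N s -> F s <= G s) ->
  seqsum M K F <= seqsum M K G.
Proof.
elim: K F G => [|K IH] F G FG /=; first exact: FG.
rewrite big_nat [leRHS]big_nat; apply: ler_sum => k kM; apply: IH => s sK sM.
by apply: FG; rewrite /= ?sK// sM andbT.
Qed.

Lemma mulr_seqsumr M K a (F : seq nat -> C) :
  a * seqsum M K F = seqsum M K (fun s => a * F s).
Proof.
elim: K F => //= K IH F; rewrite mulr_sumr.
by apply: eq_bigr => k _; rewrite IH.
Qed.

Lemma seqsumD M K (F G : seq nat -> C) :
  seqsum M K (fun s => F s + G s) = seqsum M K F + seqsum M K G.
Proof.
elim: K F G => //= K IH F G; rewrite -big_split.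
by apply: eq_bigr => k _; rewrite IH.
Qed.

Lemma expr_seqsum M K (p : nat -> C) :
  (\sum_(1 <= k < M.+1) p k) ^+ K = seqsum M K (fun s => \prod_(k <- s) p k).
Proof.
elim: K => [|K IH]; first by rewrite expr0 /= big_nil.
rewrite exprS IH mulr_suml /=; apply: eq_bigr => k _.
by rewrite mulr_seqsumr; apply: eq_seqsum => s _ _; rewrite big_cons.
Qed.

(** Each of the K + 1 positions may hold the removed k, and the other K entries then range
    freely. *)
Lemma seqsum_rmsum M K (h : seq nat -> C) k : (0 < k <= M)%N ->
  seqsum M K.+1 (fun s => rmsum s (fun l s' => (l == k)%:R * h s')) =
  K.+1%:R * seqsum M K h.
Proof.
move=> kM; elim: K h => [|K IH] h.
  rewrite mul1r /= (bigD1_seq k) ?mem_index_iota ?iota_uniq//=.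
  rewrite rmsum_cons rmsum_nil eqxx mul1r addr0 big1 ?addr0// => j jk.
  by rewrite rmsum_cons rmsum_nil (negbTE jk) mul0r addr0.
transitivity (\sum_(1 <= j < M.+1)
    ((j == k)%:R * seqsum M K.+1 h + K.+1%:R * seqsum M K (fun s => h (j :: s)))).
  rewrite seqsumS; apply: eq_bigr => j _; rewrite -IH mulr_seqsumr -seqsumD.
  by apply: eq_seqsum => s _ _; rewrite rmsum_cons.
rewrite big_split -mulr_sumr -seqsumS -[K.+2]add1n natrD mulrDl mul1r.
congr (_ + _); rewrite (bigD1_seq k) ?mem_index_iota ?iota_uniq// eqxx mul1r.
by rewrite big1 /= ?addr0// => j /negbTE ->; rewrite mul0r.
Qed.

(** This is the absolute moment of order 2K of the sum of the independent Gaussians z_1, ..., z_M,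
    itself a complex Gaussian of variance 1 + ... + M. In the induction the first index k of [la]
    can be paired with any of K + 1 positions of [mu]. *)
Lemma seqsum_wick M K :
  seqsum M K (fun la => seqsum M K (fun mu => wick la mu)) =
  K`!%:R * (\sum_(1 <= k < M.+1) k%:R) ^+ K.
Proof.
elim: K => [|K IH]; first by rewrite /= mul1r expr0.
rewrite seqsumS factS natrM exprS.
rewrite [RHS](_ : _ = \sum_(1 <= k < M.+1) k%:R * (K.+1%:R *
   seqsum M K (fun la => seqsum M K (fun mu => wick la mu)))); last first.
  by rewrite -mulr_suml IH; ring.
rewrite big_nat [RHS]big_nat; apply: eq_bigr => k kM.
rewrite mulrA mulr_seqsumr; apply: eq_seqsum => la _ _.
rewrite -mulrA -(seqsum_rmsum _ _ kM) mulr_seqsumr.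
exact: eq_seqsum.
Qed.

Lemma seqsum_wick_le M K :
  seqsum M K (fun la => seqsum M K (fun mu => wick la mu)) <=
  K`!%:R * M%:R ^+ (2 * K).
Proof.
have sM : \sum_(1 <= k < M.+1) k%:R <= M%:R ^+ 2 :> C.
  apply: (@le_trans _ _ (\sum_(1 <= k < M.+1) M%:R)).
    by apply: ler_sum_nat => k /andP[_]; rewrite ltnS ler_nat.
  by rewrite sumr_const_nat subn1 /= expr2 mulr_natr.
by rewrite seqsum_wick ler_wpM2l// exprM lerXn2r ?nnegrE ?exprn_ge0 ?sumr_ge0.
Qed.

End RemovalSum.

(** * Haar expectation *)

Section HaarExpectation.
Variables (R : realType) (N : nat).
Local Notation C := (cplx R).
Local Open Scope classical_set_scope.
Local Notation T := (unitary_borel R N).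

Lemma mulmx_continuous (V : 'M[C]_N) : continuous (fun M : 'M[C]_N => V *m M).
Proof.
move=> M A [P PM PA].
have cP i j : nbhs M (fun M' : 'M[C]_N => P i j ((V *m M') i j)).
  have : (fun M' : 'M[C]_N => \sum_k V i k * M' k j) @ M -->
      \sum_k V i k * M k j.
    apply: (@cvg_big C 'I_N +%R 0 xpredT _ 'M[C]_N (nbhs M)) => [|k _].
      exact: add_continuous.
    apply: cvgM; first exact: cvg_cst.
    exact: (@coord_continuous C N N k j).
  move=> cs; have PMij := PM i j; rewrite mxE in PMij.
  have : nbhs M (fun M' : 'M[C]_N => P i j (\sum_k V i k * M' k j)) by exact: cs PMij.
  by apply: filterS => M'; rewrite mxE.
have : nbhs M [set M' : 'M[C]_N | forall ij : 'I_N * 'I_N,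
    P ij.1 ij.2 ((V *m M') ij.1 ij.2)].
  apply: (@filter_forall _ _ (fun (ij : 'I_N * 'I_N) (M' : 'M[C]_N) =>
    P ij.1 ij.2 ((V *m M') ij.1 ij.2)) (nbhs M)) => -[i j]; exact: cP.
move=> nearP; apply: (filterS _ nearP) => M' PM'.
by apply: PA => i j; exact: (PM' (i, j)).
Qed.

Lemma open_umul (V : unitary R N) (A : set (unitary R N)) :
  open A -> open (umul V @^-1` A).
Proof.
move=> [B Bo <-].
exists ((fun M : 'M[C]_N => umx V *m M) @^-1` B); last by [].
by move/continuousP: (@mulmx_continuous (umx V)); exact.
Qed.

Lemma measurable_umul (V : unitary R N) :
  measurable_fun [set: T] (umul V : T -> T).
Proof.
apply: (measurability _ (erefl (@measurable _ T))) => _ [A oA <-].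
by rewrite setTI; apply: sub_sigma_algebra; exact: open_umul.
Qed.

Lemma measurable_entry_comp (h : C -> R) (i j : 'I_N) :
  continuous h -> measurable_fun [set: T] (fun U : T => h (umx U i j)).
Proof.
move=> ch; apply: (measurability _ (RGenOInfty.measurableE R)) => _ [_ [x ->] <-].
rewrite setTI; apply: sub_sigma_algebra.
exists ((fun M : 'M[C]_N => h (M i j)) @^-1` `]x, +oo[); last by [].
have /continuousP : continuous (fun M : 'M[C]_N => h (M i j)).
  move=> M; apply: (@continuous_comp _ _ _ (fun M : 'M[C]_N => M i j) h).
    exact: (@coord_continuous C N N i j).
  exact: ch.
by apply; exact: interval_open.
Qed.

Lemma continuous_Re : continuous (@complex.Re R : C -> R).
Proof.
move=> x A /nbhs_ballP[e /= e0 eA]; exists (e%:C)%C; first by rewrite /= ltcR.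
move=> y /=; rewrite normc_def ltcR => xy; apply: eA; apply: le_lt_trans xy.
rewrite -[_ x - _ y](raddfB (@complex.Re R)) -sqrtr_sqr.
by rewrite ler_sqrt ?lerDl ?sqr_ge0 ?addr_ge0 ?sqr_ge0.
Qed.

Lemma continuous_Im : continuous (@complex.Im R : C -> R).
Proof.
move=> x A /nbhs_ballP[e /= e0 eA]; exists (e%:C)%C; first by rewrite /= ltcR.
move=> y /=; rewrite normc_def ltcR => xy; apply: eA; apply: le_lt_trans xy.
rewrite -[_ x - _ y](raddfB (@complex.Im R)) -sqrtr_sqr.
by rewrite ler_sqrt ?lerDr ?sqr_ge0 ?addr_ge0 ?sqr_ge0.
Qed.

End HaarExpectation.

(** * Expectation of bounded complex-valued functions *)

Section ComplexExpectation.
Variables (d : measure_display) (T : measurableType d) (R : realType).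
Variable mu : probability T R.
Local Notation C := (cplx R).
Local Open Scope classical_set_scope.
Implicit Types F G : T -> C.

(** Boundedness makes integrability automatic under a probability measure and passes to products, so
    this class is an algebra stable under conjugation. *)
Definition bounded_measurable F := [/\ measurable_fun setT (fun U => complex.Re (F U)),
  measurable_fun setT (fun U => complex.Im (F U)) &
  exists B : C, forall U, `|F U| <= B].

Lemma ler_normRe (x : C) : (`|complex.Re x|%:C)%C <= `|x|.
Proof.
rewrite normc_def lecR -sqrtr_sqr ler_sqrt ?lerDl ?sqr_ge0 ?addr_ge0 ?sqr_ge0//.
Qed.

Lemma ler_normIm (x : C) : (`|complex.Im x|%:C)%C <= `|x|.
Proof.
rewrite normc_def lecR -sqrtr_sqr ler_sqrt ?lerDr ?sqr_ge0 ?addr_ge0 ?sqr_ge0//.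
Qed.

Lemma bounded_measurable_cst c : bounded_measurable (cst c).
Proof. by split; [exact: measurable_cst|exact: measurable_cst|exists `|c|]. Qed.

Lemma bounded_measurableD F G :
  bounded_measurable F -> bounded_measurable G ->
  bounded_measurable (fun U => F U + G U).
Proof.
move=> [mrF miF [B FB]] [mrG miG [D GD]]; split.
- rewrite (_ : (fun _ => _) = (fun U => complex.Re (F U)) \+ (fun U => complex.Re (G U))).
    exact: measurable_funD.
  by apply/funext => U; rewrite raddfD.
- rewrite (_ : (fun _ => _) = (fun U => complex.Im (F U)) \+ (fun U => complex.Im (G U))).
    exact: measurable_funD.
  by apply/funext => U; rewrite raddfD.
- by exists (B + D) => U; rewrite (le_trans (ler_normD _ _)) ?lerD.
Qed.

Lemma ReM (x y : C) : complex.Re (x * y) =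
  complex.Re x * complex.Re y - complex.Im x * complex.Im y.
Proof. by case: x y => a b [a' b']. Qed.

Lemma ImM (x y : C) : complex.Im (x * y) =
  complex.Re x * complex.Im y + complex.Im x * complex.Re y.
Proof. by case: x y => a b [a' b']. Qed.

Lemma bounded_measurableM F G :
  bounded_measurable F -> bounded_measurable G ->
  bounded_measurable (fun U => F U * G U).
Proof.
move=> [mrF miF [B FB]] [mrG miG [D GD]]; split.
- under eq_fun do rewrite ReM.
  by apply: measurable_funB; exact: measurable_funM.
- under eq_fun do rewrite ImM.
  by apply: measurable_funD; exact: measurable_funM.
- by exists (B * D) => U; rewrite normrM ler_pM.
Qed.

Lemma bounded_measurableZ c F :
  bounded_measurable F -> bounded_measurable (fun U => c * F U).
Proof. by apply: bounded_measurableM; exact: bounded_measurable_cst. Qed.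

Lemma bounded_measurableB F G :
  bounded_measurable F -> bounded_measurable G ->
  bounded_measurable (fun U => F U - G U).
Proof.
move=> bF bG; under eq_fun do rewrite -mulN1r.
by apply: bounded_measurableD => //; exact: bounded_measurableZ.
Qed.

Lemma bounded_measurable_conj F :
  bounded_measurable F -> bounded_measurable (fun U => (F U)^*).
Proof.
move=> [mrF miF [B FB]]; split.
- by rewrite (_ : (fun _ => _) = (fun U => complex.Re (F U)))//; apply/funext => U; case: (F U).
- rewrite (_ : (fun _ => _) = \- (fun U => complex.Im (F U))); last first.
    by apply/funext => U /=; case: (F U).
  exact: measurable_funN.
- by exists B => U; rewrite norm_conjC.
Qed.

Lemma bounded_measurable_sum (I : Type) (r : seq I) (P : pred I) (F : I -> T -> C) :
  (forall i, bounded_measurable (F i)) ->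
  bounded_measurable (fun U => \sum_(i <- r | P i) F i U).
Proof.
move=> bF; elim: r => [|i r IH].
  under eq_fun do rewrite big_nil; exact: bounded_measurable_cst.
under eq_fun do rewrite big_cons; case: (P i) => //.
exact: bounded_measurableD.
Qed.

Lemma bounded_measurable_prod (I : Type) (r : seq I) (P : pred I) (F : I -> T -> C) :
  (forall i, bounded_measurable (F i)) ->
  bounded_measurable (fun U => \prod_(i <- r | P i) F i U).
Proof.
move=> bF; elim: r => [|i r IH].
  under eq_fun do rewrite big_nil; exact: bounded_measurable_cst.
under eq_fun do rewrite big_cons; case: (P i) => //.
exact: bounded_measurableM.
Qed.

Definition cexpect F : C :=
  Complex (\int[mu]_U complex.Re (F U)) (\int[mu]_U complex.Im (F U)).

Lemma bounded_integrable (f : T -> R) (b : R) : measurable_fun setT f ->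
  (forall U, `|f U| <= b) -> mu.-integrable setT (EFin \o f).
Proof.
move=> mf fb; apply: measurable_bounded_integrable => //.
  by rewrite -ge0_fin_numE// fin_num_measure.
exists b; split; rewrite ?num_real// => x bx U _ /=.
exact: le_trans (fb U) (ltW bx).
Qed.

(** In the order of [C], [0 <= B] already says that B is real. *)
Lemma ex_real_bound F (B : C) : (forall U, `|F U| <= B) -> B = ((complex.Re B)%:C)%C.
Proof.
move=> FB; have B0 : 0 <= B by exact: le_trans (FB point).
by rewrite {1}[B]complexE (ger0_Im B0) mulr0 addr0.
Qed.

Lemma integrable_Re F : bounded_measurable F ->
  mu.-integrable setT (EFin \o (fun U => complex.Re (F U))).
Proof.
move=> [mr _ [B FB]]; apply: (@bounded_integrable _ (complex.Re B) mr) => U.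
by rewrite -lecR -(ex_real_bound FB); apply: le_trans (ler_normRe _) (FB U).
Qed.

Lemma integrable_Im F : bounded_measurable F ->
  mu.-integrable setT (EFin \o (fun U => complex.Im (F U))).
Proof.
move=> [_ mi [B FB]]; apply: (@bounded_integrable _ (complex.Re B) mi) => U.
by rewrite -lecR -(ex_real_bound FB); apply: le_trans (ler_normIm _) (FB U).
Qed.

Lemma cexpectD F G : bounded_measurable F -> bounded_measurable G ->
  cexpect (fun U => F U + G U) = cexpect F + cexpect G.
Proof.
move=> bF bG; rewrite /cexpect; under eq_Rintegral do rewrite raddfD.
under [X in Complex _ X]eq_Rintegral do rewrite raddfD.
rewrite !RintegralD//; by [exact: integrable_Re|exact: integrable_Im].
Qed.

Lemma cexpectZ c F : bounded_measurable F ->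
  cexpect (fun U => c * F U) = c * cexpect F.
Proof.
move=> bF; rewrite /cexpect; under eq_Rintegral do rewrite ReM.
under [X in Complex _ X]eq_Rintegral do rewrite ImM.
have iR := integrable_Re bF; have iI := integrable_Im bF.
have iZ (a : R) (f : T -> R) : mu.-integrable setT (EFin \o f) ->
    mu.-integrable setT (EFin \o (fun U => a * f U)).
  by move=> fi; apply: (integrableZl _ a fi).
rewrite RintegralB ?RintegralD ?RintegralZl//; try exact: iZ.
by case: c.
Qed.

Lemma cexpectB F G : bounded_measurable F -> bounded_measurable G ->
  cexpect (fun U => F U - G U) = cexpect F - cexpect G.
Proof.
move=> bF bG; under [X in cexpect X]eq_fun do rewrite -mulN1r.
by rewrite cexpectD ?cexpectZ ?mulN1r//; exact: bounded_measurableZ.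
Qed.

Lemma Rintegral_prob_cst (r : R) : (\int[mu]_U r)%R = r.
Proof.
rewrite Rintegral_cst//; transitivity (r * fine 1%E); last exact: mulr1.
by congr (_ * fine _); exact: probability_setT.
Qed.

Lemma cexpect_cst c : cexpect (cst c) = c.
Proof.
by rewrite /cexpect !Rintegral_prob_cst; case: c.
Qed.

Lemma cexpect_sum (I : Type) (r : seq I) (P : pred I) (F : I -> T -> C) :
  (forall i, bounded_measurable (F i)) ->
  cexpect (fun U => \sum_(i <- r | P i) F i U) = \sum_(i <- r | P i) cexpect (F i).
Proof.
move=> bF; elim: r => [|i r IH].
  rewrite big_nil -[RHS]cexpect_cst; congr cexpect.
  by apply/funext => U; rewrite big_nil.
rewrite big_cons -IH; case: ifPn => Pi.
  rewrite -cexpectD//; last exact: bounded_measurable_sum.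
  by congr cexpect; apply/funext => U; rewrite big_cons Pi.
by congr cexpect; apply/funext => U; rewrite big_cons (negbTE Pi).
Qed.

Lemma cexpect_conj F : bounded_measurable F ->
  cexpect (fun U => (F U)^*) = (cexpect F)^*.
Proof.
move=> bF; rewrite /cexpect [RHS]/=; congr Complex.
  by apply: eq_Rintegral => U _; case: (F U).
rewrite -mulN1r -RintegralZl//; last exact: integrable_Im.
by apply: eq_Rintegral => U _; case: (F U) => a b; rewrite mulN1r.
Qed.

(** The factor 2 comes from bounding the real and imaginary parts separately. It is harmless, since
    the bound is applied to a remainder of order t^2 that is divided by t. *)
Lemma ler_norm_cexpect F (B : C) : bounded_measurable F -> (forall U, `|F U| <= B) ->
  `|cexpect F| <= B *+ 2.
Proof.
move=> bF FB.
have rB := ex_real_bound FB; set b := complex.Re B in rB.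
have le_int (f : T -> R) : (forall U, `|f U| <= b) -> measurable_fun setT f ->
    `|\int[mu]_U f U| <= b.
  move=> fb mf; apply: le_trans (le_normr_Rintegral _ _) _ => //.
    exact: bounded_integrable fb.
  apply: (@le_trans _ _ (\int[mu]_U b)).
    apply: le_Rintegral => //.
    - by apply: (@bounded_integrable _ b); [exact: measurableT_comp|move=> U; rewrite normr_id].
    - by apply: (@bounded_integrable _ `|b|).
  by rewrite Rintegral_prob_cst.
case: (bF) => mr mi _.
rewrite {1}[cexpect F]complexE (le_trans (ler_normD _ _))// mulr2n lerD//.
  rewrite normc_def /= expr0n addr0 sqrtr_sqr rB lecR le_int// => U.
  by rewrite -lecR -rB; apply: le_trans (ler_normRe _) (FB U).
rewrite normrM [`|'i%C|]normc_def /= expr0n expr1n add0r sqrtr1 mul1r.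
rewrite normc_def /= expr0n addr0 sqrtr_sqr rB lecR le_int// => U.
by rewrite -lecR -rB; apply: le_trans (ler_normIm _) (FB U).
Qed.

(* No measurability of [f]: the integral of a nonnegative function is a
   supremum over the simple functions below it. *)
Lemma expectation_le_Re (f : T -> R) F : bounded_measurable F ->
  (forall U, 0 <= f U <= complex.Re (F U)) ->
  ('E_mu[f] <= (complex.Re (cexpect F))%:E)%E.
Proof.
move=> bF fF.
have f0 U : 0 <= f U by have /andP[] := fF U.
have F0 U : 0 <= complex.Re (F U) by have /andP[/le_trans] := fF U; exact.
have -> : (complex.Re (cexpect F))%:E = (\int[mu]_U (complex.Re (F U))%:E)%E.
  by rewrite /= fineK// integrable_fin_num//; exact: integrable_Re.
rewrite unlock !ge0_integralTE; last 2 first.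
- by move=> U; rewrite lee_fin.
- by move=> U; rewrite lee_fin.
apply: le_ereal_sup => _ [h hf <-]; exists h => // U.
by apply: le_trans (hf U) _; rewrite lee_fin; have /andP[] := fF U.
Qed.

End ComplexExpectation.

Section HaarInvariance.
Variables (R : realType) (N : nat).
Local Notation C := (cplx R).
Local Notation T := (unitary_borel R N).
Variable mu : probability T R.

Lemma haar_Rintegral (V : unitary R N) (f : T -> R) (b : R) : is_haar mu ->
  measurable_fun setT f -> (forall U, `|f U| <= b) ->
  (\int[mu]_U f (umul V U) = \int[mu]_U f U)%R.
Proof.
move=> hmu mf fb; have mV := measurable_umul V.
rewrite /Rintegral; congr fine.
transitivity (\int[pushforward mu (umul V : T -> T)]_U (f U)%:E)%E; last first.
  by apply: eq_measure_integral => A mA _; exact: hmu.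
rewrite (@integral_pushforward _ _ _ _ _ _ mV mu setT (EFin \o f))//.
  exact/measurable_EFinP.
apply: (@bounded_integrable _ _ _ mu (f \o (umul V)) b) => [|U].
  exact: measurableT_comp.
exact: fb.
Qed.

Lemma haar_cexpect (V : unitary R N) (F : T -> C) : is_haar mu ->
  bounded_measurable F -> cexpect mu (fun U => F (umul V U)) = cexpect mu F.
Proof.
move=> hmu bF; have [mr mi [B FB]] := bF; have rB := ex_real_bound FB.
rewrite /cexpect; congr Complex.
  apply: (haar_Rintegral V (b := complex.Re B) hmu mr) => U.
  by rewrite -lecR -rB; apply: le_trans (ler_normRe _) (FB U).
apply: (haar_Rintegral V (b := complex.Re B) hmu mi) => U.
by rewrite -lecR -rB; apply: le_trans (ler_normIm _) (FB U).
Qed.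

Lemma norm_umx_entry (U : unitary R N) i j : `|umx U i j : C| <= 1.
Proof.
have /unitarymxP /matrixP/(_ i i) := umx_unitary U.
rewrite !mxE eqxx mulr1n => e.
rewrite -(@expr_le1 _ 2)// -[leRHS]e (bigD1 j)//= !mxE -normCK lerDl sumr_ge0// => k _.
by rewrite !mxE -normCK exprn_ge0.
Qed.

Lemma bounded_measurable_umx i j : bounded_measurable (fun U : T => umx U i j).
Proof.
split.
- exact: (measurable_entry_comp i j (@continuous_Re R)).
- exact: (measurable_entry_comp i j (@continuous_Im R)).
- by exists 1 => U; exact: norm_umx_entry.
Qed.

End HaarInvariance.

(** * Loop equations for the moments of traces *)

Section HaarDerivative.
Variables (R : realType) (N : nat).
Local Notation C := (cplx R).
Local Notation T := (unitary_borel R N).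
Variable mu : probability T R.
Implicit Types F G : T -> C.

(* First-order expansion along a curve of left translations, with a remainder
   that is uniform in [U], so that it can be integrated. *)
Definition haar_deriv (V : R -> unitary R N) F F' := [/\ bounded_measurable F,
  bounded_measurable F' & exists2 B : C, 0 <= B & forall (t : R) U, 0 <= t <= 1 ->
  `|F (umul (V t) U) - F U - t%:C%C * F' U| <= B * t%:C%C ^+ 2].

(** By invariance F and its translate have the same expectation, so t E F' equals up to sign the
    expectation of the remainder. Hence |E F'| <= 2 B t for every t in (0, 1]. *)
Lemma haar_deriv_expect0 (V : R -> unitary R N) F F' : is_haar mu ->
  haar_deriv V F F' -> cexpect mu F' = 0.
Proof.
move=> hmu [bF bF' [B B0 FB]].
have bFV t : bounded_measurable (fun U : T => F (umul (V t) U)).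
  have [mr mi [D FD]] := bF; have mV := measurable_umul (V t); split.
  - exact: (measurableT_comp mr mV).
  - exact: (measurableT_comp mi mV).
  - by exists D => U; exact: FD.
have le t : 0 < t <= 1 -> `|cexpect mu F'| <= (B *+ 2) * t%:C%C.
  move=> /andP[t0 t1].
  have tt : 0 < t%:C%C :> C by rewrite ltcR.
  rewrite -(ler_pM2l tt) -{1}(gtr0_norm tt) -normrM -normrN.
  have bFVF := bounded_measurableB (bFV t) bF.
  have btF' := bounded_measurableZ t%:C%C bF'.
  have <- : cexpect mu (fun U : T => F (umul (V t) U) - F U - t%:C%C * F' U) =
      - (t%:C%C * cexpect mu F').
    by rewrite (cexpectB _ bFVF btF') (cexpectB _ (bFV t) bF)
      cexpectZ// haar_cexpect// subrr sub0r.
  apply: le_trans (ler_norm_cexpect (B := B * t%:C%C ^+ 2) mu _ _) _.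
  - exact: bounded_measurableB.
  - by move=> U; apply: FB; rewrite ltW.
  - by rewrite le_eqVlt; apply/orP; left; apply/eqP; ring.
apply/eqP; rewrite -normr_le0; set x := `|_| in le *.
have x0 : 0 <= x by exact: normr_ge0.
have rx : x = (complex.Re x)%:C%C by rewrite {1}[x]complexE (ger0_Im x0) mulr0 addr0.
have rB : B = (complex.Re B)%:C%C by rewrite {1}[B]complexE (ger0_Im B0) mulr0 addr0.
set y := complex.Re x in rx; set b := complex.Re B in rB.
rewrite rx (lecR _ 0); apply/ler_addgt0Pr => e e0; rewrite add0r.
have b0 : 0 <= b by move: B0; rewrite rB lecR.
(* This t makes 2 b t <= e; the added 1 keeps the denominator positive when b = 0. *)
pose t := Num.min 1 (e / (2 * b + 1)).
have p1 : 0 < 2 * b + 1 by lra.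
have t01 : 0 < t <= 1.
  by rewrite /t lt_min ltr01 divr_gt0//= ge_min lexx.
have := le t t01; rewrite rx rB -rmorphMn -rmorphM lecR => /le_trans; apply.
have te : t <= e / (2 * b + 1) by rewrite /t ge_min lexx orbT.
apply: (@le_trans _ _ ((2 * b + 1) * t)).
  by case/andP: t01 => t0 _; rewrite ler_wpM2r ?ltW// -mulr_natl; lra.
by rewrite mulrC -ler_pdivlMr.
Qed.

Variable V : R -> unitary R N.

Lemma haar_deriv_cst c : haar_deriv V (cst c) (cst 0).
Proof.
split; [exact: bounded_measurable_cst|exact: bounded_measurable_cst|].
by exists 0 => // t U _; rewrite /cst mulr0 !subrr normr0 mul0r.
Qed.

Lemma haar_derivD F F' G G' : haar_deriv V F F' -> haar_deriv V G G' ->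
  haar_deriv V (fun U => F U + G U) (fun U => F' U + G' U).
Proof.
move=> [bF bF' [B B0 FB]] [bG bG' [D D0 GD]].
split; [exact: bounded_measurableD|exact: bounded_measurableD|].
exists (B + D); first exact: addr_ge0.
move=> t U t01; rewrite mulrDl; apply: le_trans (lerD (FB t U t01) (GD t U t01)).
apply: le_trans (ler_normD _ _); rewrite le_eqVlt; apply/orP; left; apply/eqP.
by congr `|_|; ring.
Qed.

Lemma haar_derivM F F' G G' : haar_deriv V F F' -> haar_deriv V G G' ->
  haar_deriv V (fun U => F U * G U) (fun U => F' U * G U + F U * G' U).
Proof.
move=> [bF bF' [B B0 FB]] [bG bG' [D D0 GD]].
split; [exact: bounded_measurableM| |].
  by apply: bounded_measurableD; exact: bounded_measurableM.
have [_ _ [f Ff]] := bF; have [_ _ [f' Ff']] := bF'.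
have [_ _ [g Gg]] := bG; have [_ _ [g' Gg']] := bG'.
have f0 : 0 <= f by exact: le_trans (Ff point).
have f'0 : 0 <= f' by exact: le_trans (Ff' point).
have g0 : 0 <= g by exact: le_trans (Gg point).
have g'0 : 0 <= g' by exact: le_trans (Gg' point).
(* The three summands bound the pieces of the remainder identity below: the remainder of F against
   the translated G, the remainder of G against F + t F', and t^2 F' G'. *)
exists (B * g + ((f + f') * D + f' * g')).
  by rewrite !addr_ge0 ?mulr_ge0 ?addr_ge0.
move=> t U /[dup] t01 /andP[t0 t1].
have tC0 : 0 <= t%:C%C :> C by rewrite lecR.
have tC1 : t%:C%C <= 1 :> C by rewrite lecR.
set W := umul (V t) U; set s := t%:C%C in tC0 tC1 *.
have -> : F W * G W - F U * G U - s * (F' U * G U + F U * G' U) =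
  (F W - F U - s * F' U) * G W + ((F U + s * F' U) * (G W - G U - s * G' U)
   + (s ^+ 2 * (F' U * G' U))) by ring.
rewrite [leRHS]mulrDl; apply: le_trans (ler_normD _ _) _; apply: lerD.
  by rewrite normrM mulrAC ler_pM// FB.
rewrite [leRHS]mulrDl; apply: le_trans (ler_normD _ _) _; apply: lerD.
  rewrite normrM -[leRHS]mulrA ler_pM// ?GD// (le_trans (ler_normD _ _))// lerD//.
  by rewrite normrM (ger0_norm tC0) -[leRHS]mul1r ler_pM.
by rewrite normrM ger0_norm ?exprn_ge0// [leRHS]mulrC normrM ler_wpM2l ?exprn_ge0// ler_pM.
Qed.

Lemma haar_deriv_conj F F' : haar_deriv V F F' ->
  haar_deriv V (fun U => (F U)^*) (fun U => (F' U)^*).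
Proof.
move=> [bF bF' [B B0 FB]].
split; [exact: bounded_measurable_conj|exact: bounded_measurable_conj|].
exists B => // t U t01; apply: le_trans (FB t U t01).
rewrite -[leRHS]norm_conjC !rmorphB rmorphM /=.
rewrite (_ : (t%:C%C)^* = t%:C%C :> C)//; apply: conj_Creal.
by rewrite complex_real.
Qed.

Lemma haar_deriv_sum (I : Type) (r : seq I) (F F' : I -> T -> C) :
  (forall i, haar_deriv V (F i) (F' i)) ->
  haar_deriv V (fun U => \sum_(i <- r) F i U) (fun U => \sum_(i <- r) F' i U).
Proof.
move=> dF; elim: r => [|i r IH].
  under eq_fun do rewrite big_nil; under [X in haar_deriv _ _ X]eq_fun do rewrite big_nil.
  exact: haar_deriv_cst.
under eq_fun do rewrite big_cons; under [X in haar_deriv _ _ X]eq_fun do rewrite big_cons.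
exact: haar_derivD.
Qed.

Lemma haar_deriv_prod (s : seq nat) (p dp : nat -> T -> C) :
  (forall k, haar_deriv V (p k) (dp k)) ->
  haar_deriv V (fun U => \prod_(k <- s) p k U)
    (fun U => rmsum s (fun k s' => dp k U * \prod_(j <- s') p j U)).
Proof.
move=> dP; elim: s => [|k s IH].
  under eq_fun do rewrite big_nil; under [X in haar_deriv _ _ X]eq_fun do rewrite rmsum_nil.
  exact: haar_deriv_cst.
under eq_fun do rewrite big_cons.
rewrite (_ : (fun U => rmsum (k :: s) _) = fun U =>
   dp k U * (\prod_(j <- s) p j U) +
   p k U * rmsum s (fun k s' => dp k U * \prod_(j <- s') p j U)).
  exact: haar_derivM.
apply/funext => U; rewrite rmsum_cons mulr_rmsumr; congr (_ + _).
by apply: eq_rmsum => l s' _; rewrite big_cons mulrCA.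
Qed.

End HaarDerivative.

(** * Unitary curves generated by orthogonal projections *)

Section Curve.
Local Open Scope sesquilinear_scope.
Variables (R : realType) (N : nat).
Local Notation C := (cplx R).
Local Notation T := (unitary_borel R N).
Variable X : 'M[C]_N.
Hypotheses (Xherm : X ^t* = X) (Xidem : X *m X = X).

(* The Cayley transform [(1 + i t) / (1 - i t)] is the point of the circle used
   instead of [exp (2 i t)], so that only algebra is needed. *)
Definition cayley (t : R) : C := (1 + 'i * t%:C%C) / (1 - 'i * t%:C%C).

Lemma real_complex_real (t : R) : (t%:C%C : C) \is Num.real.
Proof. by rewrite complex_real. Qed.

Lemma norm_cayley_den (t : R) : `|1 - 'i * t%:C%C : C| ^+ 2 = 1 + t%:C%C ^+ 2.
Proof.
have tr := real_complex_real t.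
by rewrite -mulrN normC2_rect ?expr1n ?sqrrN ?rpred1 ?rpredN.
Qed.

Lemma cayley_den_ge1 (t : R) : 1 <= `|1 - 'i * t%:C%C : C|.
Proof.
rewrite -(@ler_pXn2r _ 2) ?nnegrE ?normr_ge0// expr1n norm_cayley_den.
by rewrite lerDl real_exprn_even_ge0// real_complex_real.
Qed.

Lemma cayley_den_neq0 (t : R) : 1 - 'i * t%:C%C != 0 :> C.
Proof. by rewrite -normr_gt0 (lt_le_trans ltr01)// cayley_den_ge1. Qed.

Lemma cayley_unit (t : R) : cayley t * (cayley t)^* = 1.
Proof.
rewrite -normCK normrM normfV exprMn exprVn norm_cayley_den.
have := norm_cayley_den (- t); rewrite rmorphN mulrN opprK sqrrN => ->.
by rewrite divff// -norm_cayley_den expf_eq0/= normr_eq0 cayley_den_neq0.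
Qed.

Lemma cayley_expansion (t : R) :
  `|cayley t - 1 - t%:C%C * (2 * 'i)| <= 2 * `|t%:C%C : C| ^+ 2.
Proof.
have d := cayley_den_neq0 t.
have -> : cayley t - 1 - t%:C%C * (2 * 'i) = - 2 * t%:C%C ^+ 2 / (1 - 'i * t%:C%C).
  have -> : - 2 = 2 * 'i ^+ 2 :> C by rewrite sqrCi mulrN1.
  by rewrite /cayley; field.
rewrite normf_div normrM normrX normrN normr_nat ler_pdivrMr ?normr_gt0//.
by rewrite ler_peMr ?cayley_den_ge1// mulr_ge0 ?exprn_ge0.
Qed.

(** [X] is an orthogonal projection, so this matrix multiplies its range by the unimodular number
    [cayley t] and fixes the orthogonal complement. *)
Lemma curve_subproof t : (1%:M + (cayley t - 1) *: X) \in @unitary_set R N.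
Proof.
apply/mem_set/unitarymxP.
rewrite linearD linearZ/= trmx1 map_mxD map_mx1 map_mxZ /= Xherm.
rewrite mulmxDl !mulmxDr !mul1mx mulmx1 -scalemxAl -scalemxAr Xidem scalerA.
set c := cayley t; set a := c - 1; set b := a^*.
have ab : b + (a + a * b) = 0.
  rewrite /b /a rmorphB rmorph1 /=.
  have -> : c^* - 1 + (c - 1 + (c - 1) * (c^* - 1)) = c * c^* - 1 by ring.
  by rewrite cayley_unit subrr.
by rewrite -addrA -!scalerDl ab scale0r addr0.
Qed.

Definition curve t : unitary R N :=
  exist (fun M => M \in @unitary_set R N) _ (curve_subproof t).

Lemma haar_deriv_umx i j : haar_deriv curve (fun U : T => umx U i j)
  (fun U => (((2 * 'i) *: X) *m umx U) i j).
Proof.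
have bX : bounded_measurable (fun U : T => (X *m umx U) i j).
  under eq_fun do rewrite mxE; apply: bounded_measurable_sum => k.
  exact/bounded_measurableZ/bounded_measurable_umx.
have eX (U : T) : (((2 * 'i) *: X) *m umx U) i j = 2 * 'i * (X *m umx U) i j.
  by rewrite -scalemxAl mxE.
split; first exact: bounded_measurable_umx.
  by under eq_fun do rewrite eX; exact: bounded_measurableZ.
have [_ _ [B XB]] := bX; have B0 : 0 <= B by exact: le_trans (XB point).
exists (2 * B) => [|t U t01]; first by rewrite mulr_ge0.
have -> : umx (umul (curve t) U) i j - umx U i j = (cayley t - 1) * (X *m umx U) i j.
  by rewrite /umx /= mulmxDl mul1mx -scalemxAl !mxE [_ + _ - _]addrC addrA addNr add0r.
rewrite eX mulrA -mulrBl normrM mulrAC ler_pM//.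
apply: le_trans (cayley_expansion t) _.
by rewrite ger0_norm// lecR; case/andP: t01.
Qed.

End Curve.

(** * Derivatives of powers and of products of traces *)

Section PowerDerivative.
Variables (F : pzRingType) (N : nat).
Implicit Types A B U : 'M[F]_N.

(* The derivative of [U ^+ k] when [U] moves in the direction [A *m U]. *)
Definition dpow A k U := \sum_(l < k) U ^+ l *m A *m U ^+ (k - l).

Lemma dpowS A k U : dpow A k.+1 U = (A *m U) *m U ^+ k + U *m dpow A k U.
Proof.
rewrite /dpow big_ord_recl expr0 mul1mx subn0 exprS -mulmxA; congr (_ + _).
by rewrite mulmx_sumr; apply: eq_bigr => l _; rewrite subSS exprS !mulmxA.
Qed.

End PowerDerivative.

(** Cyclicity of the trace makes the k summands equal. *)
Lemma mxtrace_dpow (F : comPzRingType) N (A U : 'M[F]_N) k :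
  \tr (dpow A k U) = k%:R * \tr (A *m U ^+ k).
Proof.
rewrite /dpow raddf_sum -[k in k%:R]card_ord mulr_natl -sumr_const.
apply: eq_bigr => l _ /=.
rewrite -mulmxA mxtrace_mulC -mulmxA; congr (\tr (_ *m _)).
by rewrite mulmxE -exprD subnK// ltnW.
Qed.

Lemma dpow_is_linear (F : comPzRingType) N c (A B U : 'M[F]_N) k :
  dpow (c *: A + B) k U = c *: dpow A k U + dpow B k U.
Proof.
rewrite /dpow scaler_sumr -big_split; apply: eq_bigr => l _ /=.
by rewrite mulmxDr mulmxDl -scalemxAr -scalemxAl.
Qed.

(** Entrywise form of the polarization that writes u w^* through four matrices v v^*; x' and y'
    stand for the conjugated entries. *)
Lemma polarization4 (F : comPzRingType) (i x y x' y' : F) : i * i = -1 ->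
  4 * (x * y') = (x + y) * (x' + y') - (x - y) * (x' - y')
    + i * ((x + i * y) * (x' - i * y')) - i * ((x - i * y) * (x' + i * y')).
Proof.
move=> i2; transitivity (2 * (x * y' + y * x') - 2 * (i * i) * (x * y' - y * x')).
  by rewrite i2; ring.
ring.
Qed.

Section WordDerivative.
Local Open Scope sesquilinear_scope.
Variables (R : realType) (N : nat).
Local Notation C := (cplx R).
Local Notation T := (unitary_borel R N).
Variable mu : probability T R.
Hypothesis hmu : is_haar mu.

Definition ptrace (k : nat) (U : T) : C := \tr ((umx U : 'M[C]_N) ^+ k).
Definition ptraces (s : seq nat) (U : T) : C := \prod_(k <- s) ptrace k U.

Lemma bounded_measurable_umxX k i j :
  bounded_measurable (fun U : T => ((umx U : 'M[C]_N) ^+ k) i j).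
Proof.
elim: k i j => [|k IH] i j.
  under eq_fun do rewrite expr0 mxE; exact: bounded_measurable_cst.
under eq_fun do rewrite exprS mxE; apply: bounded_measurable_sum => l.
by apply: bounded_measurableM => //; exact: bounded_measurable_umx.
Qed.

Lemma bounded_measurable_ptrace k : bounded_measurable (ptrace k).
Proof. by apply: bounded_measurable_sum => i; exact: bounded_measurable_umxX. Qed.

Lemma bounded_measurable_ptraces s : bounded_measurable (ptraces s).
Proof. by apply: bounded_measurable_prod => k; exact: bounded_measurable_ptrace. Qed.

Lemma bounded_measurable_rmsum s (f : nat -> seq nat -> T -> C) :
  (forall l s', bounded_measurable (f l s')) ->
  bounded_measurable (fun U => rmsum s (fun l s' => f l s' U)).
Proof. by move=> bf; apply: bounded_measurable_sum => i; exact: bf. Qed.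

Lemma bounded_measurable_dpow A k i j :
  bounded_measurable (fun U : T => dpow A k (umx U : 'M[C]_N) i j).
Proof.
rewrite /dpow; under eq_fun do rewrite summxE.
apply: bounded_measurable_sum => l.
under eq_fun do rewrite mxE; apply: bounded_measurable_sum => m.
apply: bounded_measurableM; last exact: bounded_measurable_umxX.
under eq_fun do rewrite mxE; apply: bounded_measurable_sum => n.
apply: bounded_measurableM; last exact: bounded_measurable_cst.
exact: bounded_measurable_umxX.
Qed.

Lemma bounded_measurable_trM A k :
  bounded_measurable (fun U : T => \tr (A *m (umx U : 'M[C]_N) ^+ k)).
Proof.
apply: bounded_measurable_sum => i; under eq_fun do rewrite mxE.
apply: bounded_measurable_sum => j; apply: bounded_measurableZ.
exact: bounded_measurable_umxX.
Qed.

Lemma bounded_measurable_trMC A k :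
  bounded_measurable (fun U : T => \tr (A *m ((umx U : 'M[C]_N) ^+ k) ^t*)).
Proof.
apply: bounded_measurable_sum => i; under eq_fun do rewrite mxE.
apply: bounded_measurable_sum => j; apply: bounded_measurableZ.
under eq_fun do rewrite !mxE; apply: bounded_measurable_conj.
exact: bounded_measurable_umxX.
Qed.

(* The derivative of [(U ^+ k) i j * ptraces la U * (ptraces nu U)^*] in the
   direction [A], extended complex-linearly from skew-Hermitian [A]. *)
Definition word_deriv k i j la nu (A : 'M[C]_N) (U : T) : C :=
  let M := umx U : 'M[C]_N in
  dpow A k M i j * (ptraces la U * (ptraces nu U)^*) +
  (M ^+ k) i j *
   (rmsum la (fun m la' => m%:R * \tr (A *m M ^+ m) * ptraces la' U) * (ptraces nu U)^*
    - ptraces la U *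
      rmsum nu (fun l nu' => l%:R * \tr (A *m (M ^+ l) ^t*) * (ptraces nu' U)^*)).

Lemma bounded_measurable_word_deriv k i j la nu A :
  bounded_measurable (word_deriv k i j la nu A).
Proof.
have bP s := bounded_measurable_ptraces s.
have bQ s := bounded_measurable_conj (bP s).
rewrite /word_deriv /=; apply: bounded_measurableD; apply: bounded_measurableM.
- exact: bounded_measurable_dpow.
- exact: bounded_measurableM.
- exact: bounded_measurable_umxX.
- apply: bounded_measurableB; apply: bounded_measurableM => //.
    apply: bounded_measurable_rmsum => m la'; apply: bounded_measurableM => //.
    exact/bounded_measurableZ/bounded_measurable_trM.
  apply: bounded_measurable_rmsum => m la'; apply: bounded_measurableM => //.
  exact/bounded_measurableZ/bounded_measurable_trMC.
Qed.

Lemma word_deriv_is_linear k i j la nu c A B U :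
  word_deriv k i j la nu (c *: A + B) U =
  c * word_deriv k i j la nu A U + word_deriv k i j la nu B U.
Proof.
rewrite /word_deriv /= dpow_is_linear; set M : 'M[C]_N := umx U.
have -> : (c *: dpow A k M + dpow B k M) i j = c * dpow A k M i j + dpow B k M i j.
  by rewrite !mxE.
rewrite (_ : rmsum la _ =
   c * rmsum la (fun m la' => m%:R * \tr (A *m M ^+ m) * ptraces la' U)
   + rmsum la (fun m la' => m%:R * \tr (B *m M ^+ m) * ptraces la' U)); last first.
  rewrite mulr_rmsumr rmsumD; apply: eq_rmsum => m la' _.
  by rewrite mulmxDl -scalemxAl mxtraceD mxtraceZ; ring.
rewrite (_ : rmsum nu _ =
   c * rmsum nu (fun l nu' => l%:R * \tr (A *m (M ^+ l) ^t*) * (ptraces nu' U)^*)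
   + rmsum nu (fun l nu' => l%:R * \tr (B *m (M ^+ l) ^t*) * (ptraces nu' U)^*)); last first.
  rewrite mulr_rmsumr rmsumD; apply: eq_rmsum => m nu' _.
  by rewrite mulmxDl -scalemxAl mxtraceD mxtraceZ; ring.
move: (dpow A k M i j) (dpow B k M i j) ((M ^+ k) i j) (ptraces la U) (_^*)
  (rmsum la _) (rmsum la _) (rmsum nu _) (rmsum nu _) => a b m p q x x' y y'.
ring.
Qed.

Section Direction.
Variable X : 'M[C]_N.
Hypotheses (Xherm : X ^t* = X) (Xidem : X *m X = X).
Let A := (2 * 'i) *: X.
Let V := curve Xherm Xidem.

Lemma haar_deriv_umxX k i j : haar_deriv V
  (fun U : T => ((umx U : 'M[C]_N) ^+ k) i j) (fun U => dpow A k (umx U) i j).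
Proof.
elim: k i j => [|k IH] i j.
  under eq_fun do rewrite expr0 mxE.
  under [X in haar_deriv _ _ X]eq_fun do rewrite /dpow big_ord0 mxE.
  exact: haar_deriv_cst.
under eq_fun do rewrite exprS mxE.
under [X in haar_deriv _ _ X]eq_fun do rewrite dpowS !mxE -big_split /=.
apply: haar_deriv_sum => l; apply: haar_derivM => //.
exact: haar_deriv_umx.
Qed.

Lemma haar_deriv_ptrace k : haar_deriv V (ptrace k)
  (fun U => k%:R * \tr (A *m (umx U : 'M[C]_N) ^+ k)).
Proof.
under [X in haar_deriv _ _ X]eq_fun do rewrite -mxtrace_dpow.
by apply: haar_deriv_sum => i; exact: haar_deriv_umxX.
Qed.

Lemma cexpect_word_deriv_proj k i j la nu : cexpect mu (word_deriv k i j la nu A) = 0.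
Proof.
apply: (haar_deriv_expect0 (V := V)
  (F := fun U => ((umx U : 'M[C]_N) ^+ k) i j * (ptraces la U * (ptraces nu U)^*))) => //.
rewrite (_ : word_deriv _ _ _ _ _ _ = fun U : T =>
   dpow A k (umx U) i j * (ptraces la U * (ptraces nu U)^*) +
   ((umx U : 'M[C]_N) ^+ k) i j *
   (rmsum la (fun m la' => m%:R * \tr (A *m (umx U : 'M[C]_N) ^+ m) * ptraces la' U)
      * (ptraces nu U)^*
    + ptraces la U * (rmsum nu (fun l nu' => l%:R * \tr (A *m (umx U : 'M[C]_N) ^+ l)
      * ptraces nu' U))^*)).
  apply: haar_derivM; first exact: haar_deriv_umxX.
  apply: haar_derivM; last apply: haar_deriv_conj.
    by apply: haar_deriv_prod => l; exact: haar_deriv_ptrace.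
  by apply: haar_deriv_prod => l; exact: haar_deriv_ptrace.
apply/funext => U; rewrite /word_deriv /=; congr (_ + _ * (_ + _)).
rewrite -mulrN; congr (_ * _).
rewrite /rmsum rmorph_sum -sumrN; apply: eq_bigr => l _ /=.
rewrite !rmorphM /= conjC_nat -mulNr -mulrN; congr (_ * _ * _).
have -> : (\tr (A *m (umx U : 'M[C]_N) ^+ nth 0%N nu l))^* =
    \tr ((A *m (umx U : 'M[C]_N) ^+ nth 0%N nu l) ^t*).
  by rewrite trace_map_mx mxtrace_tr.
(* Skew-symmetry moves the conjugate off A at the price of a sign: the source of the minus in
   [word_deriv]. *)
have Ask : A ^t* = - A.
  by rewrite /A linearZ/= map_mxZ Xherm /= rmorphM /= conjC_nat conjCi mulrN scaleNr.
by rewrite trmx_mul map_mxM Ask mulmxN raddfN mxtrace_mulC.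
Qed.

End Direction.

(** The expectation is complex-linear in A and vanishes on 2 i X for rank-one orthogonal projections
    X, hence on every v v^*, by polarization on every u w^*, and so on the matrix units, which
    span. *)
Lemma cexpect_word_deriv k i j la nu A : cexpect mu (word_deriv k i j la nu A) = 0.
Proof.
pose Phi B := cexpect mu (word_deriv k i j la nu B).
have PhiZD c B B' : Phi (c *: B + B') = c * Phi B + Phi B'.
  rewrite /Phi (_ : word_deriv _ _ _ _ _ (c *: B + B') = fun U =>
    c * word_deriv k i j la nu B U + word_deriv k i j la nu B' U); last first.
    by apply/funext => U; rewrite word_deriv_is_linear.
  have bw B0 := bounded_measurable_word_deriv k i j la nu B0.
  by rewrite cexpectD ?cexpectZ//; exact: bounded_measurableZ.
have Phi0 : Phi 0 = 0.
  by have := PhiZD (-1) 0 0; rewrite scaler0 addr0 mulN1r addNr.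
have PhiZ c B : Phi (c *: B) = c * Phi B by rewrite -[c *: B]addr0 PhiZD Phi0 addr0.
have PhiD B B' : Phi (B + B') = Phi B + Phi B' by rewrite -[B]scale1r PhiZD mul1r scale1r.
have PhiN B : Phi (- B) = - Phi B by rewrite -scaleN1r PhiZ mulN1r.
have Phi_rank1 (v : 'cV[C]_N) : Phi (v *m v ^t*) = 0.
  have [->|v0] := eqVneq v 0; first by rewrite mul0mx.
  pose s := (v ^t* *m v) 0 0.
  have vv : v ^t* *m v = s%:M by exact: mx11_scalar.
  have sE : s = \sum_l `|v l 0| ^+ 2.
    by rewrite /s mxE; apply: eq_bigr => l _; rewrite !mxE normCKC.
  have s0 : s != 0.
    apply: contra v0 => /eqP; rewrite sE => /psumr_eq0P s00.
    apply/eqP/matrixP => l m; rewrite (ord1 m) mxE.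
    by apply/eqP; rewrite -normr_eq0 -sqrf_eq0 s00// => ? _; rewrite exprn_ge0.
  have sr : s^* = s.
    by apply: conj_Creal; rewrite sE rpred_sum// => l _; rewrite rpredX// normr_real.
  (* Dividing by the squared length s of v makes v v^* idempotent. *)
  pose X := s^-1 *: (v *m v ^t*).
  have Xherm : X ^t* = X.
    by rewrite /X linearZ/= map_mxZ /= trmx_mul map_mxM trmxCK fmorphV /= sr.
  have Xidem : X *m X = X.
    rewrite /X -scalemxAl -scalemxAr -mulmxA (mulmxA (v ^t*)) vv mul_scalar_mx.
    by rewrite -scalemxAr !scalerA mulVf ?mulr1.
  have := cexpect_word_deriv_proj Xherm Xidem k i j la nu.
  rewrite -/(Phi _) PhiZ /X PhiZ mulrA => e0.
  have nz : 2 * 'i * s^-1 != 0 :> C.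
    by rewrite mulf_neq0 ?invr_neq0// mulf_neq0 ?neq0Ci// (pnatr_eq0 C 2).
  by apply: (mulfI nz); rewrite e0 mulr0.
have Phi_rank1' (u w : 'cV[C]_N) : Phi (u *m w ^t*) = 0.
  have e4 : 4 *: (u *m w ^t*) = (u + w) *m (u + w) ^t* - (u - w) *m (u - w) ^t*
     + 'i *: ((u + 'i *: w) *m (u + 'i *: w) ^t*)
     - 'i *: ((u - 'i *: w) *m (u - 'i *: w) ^t*).
    apply/matrixP => a b.
    have e (u' w' : 'cV[C]_N) : (u' *m w' ^t*) a b = u' a 0 * (w' b 0)^*.
      by rewrite !mxE big_ord1 !mxE.
    have eD (B B' : 'M[C]_N) : (B + B') a b = B a b + B' a b by rewrite mxE.
    have eN (B : 'M[C]_N) : (- B) a b = - B a b by rewrite mxE.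
    have eZ c (B : 'M[C]_N) : (c *: B) a b = c * B a b by rewrite mxE.
    have vD (v v' : 'cV[C]_N) l : (v + v') l 0 = v l 0 + v' l 0 by rewrite mxE.
    have vN (v : 'cV[C]_N) l : (- v) l 0 = - v l 0 by rewrite mxE.
    have vZ c (v : 'cV[C]_N) l : (c *: v) l 0 = c * v l 0 by rewrite mxE.
    rewrite !(eD, eN, eZ, e) !(vD, vN, vZ) !(rmorphD, rmorphN, rmorphM) /= conjCi.
    rewrite mulNr opprK; apply: polarization4.
    by rewrite -expr2 sqrCi.
  have := PhiZ 4 (u *m w ^t*); rewrite e4 !(PhiD, PhiN, PhiZ) !Phi_rank1.
  rewrite !mulr0 !oppr0 !addr0 => e0.
  have nz : 4 != 0 :> C by rewrite (pnatr_eq0 C 4).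
  by apply: (mulfI nz); rewrite mulr0 -e0.
rewrite -/(Phi A) (matrix_sum_delta A).
have Phi_sum (r : seq 'I_N) (B : 'I_N -> 'M[C]_N) : (forall l, Phi (B l) = 0) ->
    Phi (\sum_(l <- r) B l) = 0.
  move=> B0; elim: r => [|l r IH]; first by rewrite big_nil.
  by rewrite big_cons PhiD B0 IH addr0.
apply: (Phi_sum) => a; apply: Phi_sum => b; rewrite PhiZ.
have -> : delta_mx a b = (delta_mx a 0 : 'cV[C]_N) *m (delta_mx b 0 : 'cV[C]_N) ^t*.
  by rewrite trmx_delta map_delta_mx mul_delta_mx.
by rewrite Phi_rank1' mulr0.
Qed.

End WordDerivative.

(** * Contraction over the matrix units: cut and join *)

Section LoopEquation.
Local Open Scope sesquilinear_scope.
Variables (R : realType) (N : nat).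
Local Notation C := (cplx R).
Local Notation T := (unitary_borel R N).
Variable mu : probability T R.
Hypothesis hmu : is_haar mu.

Definition trace_moment la nu : C :=
  cexpect mu (fun U : T => ptraces la U * (ptraces nu U)^*).

Lemma ptrace0 (U : T) : ptrace 0 U = N%:R.
Proof. by rewrite /ptrace expr0 mxtrace1. Qed.

Lemma mxtrace_umxXC k l (U : T) :
  \tr ((umx U : 'M[C]_N) ^+ k *m ((umx U : 'M[C]_N) ^+ l) ^t*) =
  if (l < k)%N then ptrace (k - l) U else if (k < l)%N then (ptrace (l - k) U)^*
  else N%:R.
Proof.
set M : 'M[C]_N := umx U.
have MX n : M ^+ n *m (M ^+ n) ^t* = 1%:M.
  elim: n => [|n IH]; first by rewrite expr0 trmx1 map_mx1 mulmx1.
  rewrite exprSr -mulmxE trmx_mul map_mxM -mulmxA (mulmxA M).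
  by rewrite (unitarymxP (umx_unitary U)) mul1mx.
have tr m : \tr ((M ^+ m) ^t*) = (ptrace m U)^*.
  by rewrite trace_map_mx mxtrace_tr.
have [lk|kl|->] := ltngtP l k.
- by rewrite -(subnK (ltnW lk)) exprD -mulmxE -mulmxA MX mulmx1 addnK.
- rewrite -tr -{1}(subnK (ltnW kl)) exprD -mulmxE trmx_mul map_mxM.
  by rewrite mulmxA MX mul1mx.
- by rewrite MX mxtrace1.
Qed.

(** Contraction fuses two traces into one: the origin of the joining terms. *)
Lemma sum_delta_mx (M B : 'M[C]_N) :
  \sum_i \sum_j M i j * \tr (delta_mx i j *m B) = \tr (M *m B).
Proof.
apply: eq_bigr => i _; rewrite mxE; apply: eq_bigr => j _; congr (_ * _).
rewrite /mxtrace (bigD1 i)//= big1 ?addr0 => [|l li].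
  rewrite mxE (bigD1 j)//= big1 ?addr0 => [|m mj]; first by rewrite mxE !eqxx mul1r.
  by rewrite mxE (negbTE mj) andbF mul0r.
by rewrite mxE big1// => m _; rewrite mxE (negbTE li) mul0r.
Qed.

(** The (i, j) entry of M^l E_ij M^(k-l) is a product of two diagonal entries, so one power breaks
    into two traces: the origin of the splitting terms. *)
Lemma sum_dpow_delta_mx k (M : 'M[C]_N) :
  \sum_i \sum_j dpow (delta_mx i j) k M i j =
  \sum_(l < k) \tr (M ^+ l) * \tr (M ^+ (k - l)).
Proof.
rewrite /dpow; under eq_bigr do under eq_bigr do rewrite summxE.
under eq_bigr do rewrite exchange_big.
rewrite exchange_big; apply: eq_bigr => l _.
rewrite mulr_suml; apply: eq_bigr => i _; rewrite mulr_sumr; apply: eq_bigr => j _.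
rewrite mxE (bigD1 j)//= big1 ?addr0 => [|m mj].
  congr (_ * _); rewrite mxE (bigD1 i)//= big1 ?addr0 => [|m mi].
    by rewrite mxE !eqxx mulr1.
  by rewrite mxE (negbTE mi) mulr0.
rewrite mxE big1 ?mul0r// => n _.
by rewrite mxE (negbTE mj) andbF mulr0.
Qed.

Lemma sum_rmsum_delta_mx s (B : 'M[C]_N) (D : nat -> 'M[C]_N) (a : nat -> C)
  (b : seq nat -> C) :
  \sum_i \sum_j B i j * rmsum s (fun l s' => a l * \tr (delta_mx i j *m D l) * b s') =
  rmsum s (fun l s' => a l * \tr (B *m D l) * b s').
Proof.
under eq_bigr do under eq_bigr do rewrite mulr_rmsumr.
under eq_bigr do rewrite exchange_big.
rewrite exchange_big; apply: eq_bigr => l _ /=.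
set m := nth _ _ _; set s' := _ ++ _.
rewrite -sum_delta_mx mulr_sumr mulr_suml; apply: eq_bigr => i _.
rewrite mulr_sumr mulr_suml; apply: eq_bigr => j _.
by rewrite !mulrA (mulrC (B i j)).
Qed.

Lemma sum_word_deriv k la nu (U : T) : (0 < k)%N ->
  \sum_i \sum_j word_deriv k i j la nu (delta_mx i j) U =
  N%:R * (ptraces (k :: la) U * (ptraces nu U)^*)
  + \sum_(1 <= l < k) ptraces [:: l, (k - l)%N & la] U * (ptraces nu U)^*
  + rmsum la (fun m la' => m%:R * (ptraces ((k + m)%N :: la') U * (ptraces nu U)^*))
  - rmsum nu (fun l nu' => l%:R *
    (if (l < k)%N then ptraces ((k - l)%N :: la) U * (ptraces nu' U)^*
     else if (k < l)%N then ptraces la U * (ptraces ((l - k)%N :: nu') U)^*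
     else N%:R * (ptraces la U * (ptraces nu' U)^*))).
Proof.
move=> k0; rewrite /word_deriv; set M : 'M[C]_N := umx U.
set P := ptraces la U; set Q := (ptraces nu U)^*.
have e1 : \sum_i \sum_j dpow (delta_mx i j) k M i j * (P * Q) =
    (\sum_(l < k) \tr (M ^+ l) * \tr (M ^+ (k - l))) * (P * Q).
  rewrite -sum_dpow_delta_mx mulr_suml; apply: eq_bigr => i _.
  by rewrite mulr_suml.
have e2 : \sum_i \sum_j (M ^+ k) i j * (rmsum la (fun m la' =>
      m%:R * \tr (delta_mx i j *m M ^+ m) * ptraces la' U) * Q) =
    rmsum la (fun m la' => m%:R * \tr (M ^+ k *m M ^+ m) * ptraces la' U) * Q.
  rewrite -sum_rmsum_delta_mx mulr_suml; apply: eq_bigr => i _.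
  by rewrite mulr_suml; apply: eq_bigr => j _; rewrite mulrA.
have e3 : \sum_i \sum_j (M ^+ k) i j * (P * rmsum nu (fun l nu' =>
      l%:R * \tr (delta_mx i j *m (M ^+ l) ^t*) * (ptraces nu' U)^*)) =
    P * rmsum nu (fun l nu' => l%:R * \tr (M ^+ k *m (M ^+ l) ^t*) * (ptraces nu' U)^*).
  rewrite -(sum_rmsum_delta_mx _ _ (fun l => (M ^+ l) ^t*) (fun l => l%:R)
    (fun s => (ptraces s U)^*)).
  rewrite mulr_sumr; apply: eq_bigr => i _.
  by rewrite mulr_sumr; apply: eq_bigr => j _; rewrite mulrCA.
transitivity ((\sum_(l < k) \tr (M ^+ l) * \tr (M ^+ (k - l))) * (P * Q) +
   (rmsum la (fun m la' => m%:R * \tr (M ^+ k *m M ^+ m) * ptraces la' U) * Q -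
    P * rmsum nu (fun l nu' => l%:R * \tr (M ^+ k *m (M ^+ l) ^t*) * (ptraces nu' U)^*))).
  rewrite -e1 -e2 -e3 -sumrB -big_split; apply: eq_bigr => i _ /=.
  by rewrite -sumrB -big_split; apply: eq_bigr => j _ /=; rewrite mulrBr.
rewrite addrA; congr (_ + _ - _).
- rewrite -(big_mkord xpredT (fun l => \tr (M ^+ l) * \tr (M ^+ (k - l)))).
  (* The term l = 0 contains the trace of the identity and becomes the leading term N p_k. *)
  rewrite big_ltn// subn0 mulrDl -![\tr (M ^+ _)]/(ptrace _ U) ptrace0.
  congr (_ + _); first by rewrite /ptraces big_cons -/(ptraces la U) -/P -!mulrA.
  rewrite mulr_suml; apply: eq_bigr => l _.
  by rewrite /ptraces !big_cons -/(ptraces la U) -/P !mulrA.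
- rewrite mulrC mulr_rmsumr; apply: eq_rmsum => m la' _.
  by rewrite /ptraces big_cons mulmxE -exprD -/(ptrace _ U); ring.
- rewrite mulr_rmsumr; apply: eq_rmsum => l nu' _.
  rewrite mxtrace_umxXC mulrCA -mulrA; congr (_ * _).
  case: ltngtP => _; last by ring.
    by rewrite /ptraces big_cons -/(ptraces la U) -/P; ring.
  by rewrite /ptraces big_cons rmorphM /= -/(ptraces la U) -/P; ring.
Qed.

Lemma loop_eq_trace_moment : loop_eq N trace_moment.
Proof.
move=> k la nu k0 _ _.
have bM s t : bounded_measurable (fun U : T => ptraces s U * (ptraces t U)^*).
  apply: bounded_measurableM; last apply: bounded_measurable_conj.
    exact: bounded_measurable_ptraces.
  exact: bounded_measurable_ptraces.
have bW i j A : bounded_measurable (word_deriv k i j la nu A).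
  exact: bounded_measurable_word_deriv.
have : cexpect mu (fun U => \sum_i \sum_j word_deriv k i j la nu (delta_mx i j) U) = 0.
  rewrite cexpect_sum => [|i]; last exact: bounded_measurable_sum.
  rewrite big1// => i _; rewrite cexpect_sum// big1// => j _.
  exact: cexpect_word_deriv.
under [X in cexpect mu X]eq_fun do rewrite sum_word_deriv//.
have bJ : bounded_measurable (fun U : T => rmsum la (fun m la' =>
    m%:R * (ptraces ((k + m)%N :: la') U * (ptraces nu U)^*))).
  by apply: bounded_measurable_rmsum => m la'; exact: bounded_measurableZ.
have bS : bounded_measurable (fun U : T => \sum_(1 <= l < k)
    ptraces [:: l, (k - l)%N & la] U * (ptraces nu U)^*).
  by apply: bounded_measurable_sum.
have bK l nu' : bounded_measurable (fun U : T =>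
    if (l < k)%N then ptraces ((k - l)%N :: la) U * (ptraces nu' U)^*
    else if (k < l)%N then ptraces la U * (ptraces ((l - k)%N :: nu') U)^*
    else N%:R * (ptraces la U * (ptraces nu' U)^*)).
  by case: ltngtP => _ //; exact: bounded_measurableZ.
have bR : bounded_measurable (fun U : T => rmsum nu (fun l nu' => l%:R *
    (if (l < k)%N then ptraces ((k - l)%N :: la) U * (ptraces nu' U)^*
     else if (k < l)%N then ptraces la U * (ptraces ((l - k)%N :: nu') U)^*
     else N%:R * (ptraces la U * (ptraces nu' U)^*)))).
  by apply: bounded_measurable_rmsum => l nu'; exact: bounded_measurableZ.
have bN := bounded_measurableZ N%:R (bM (k :: la) nu).
rewrite cexpectB//; last by apply: bounded_measurableD => //; exact: bounded_measurableD.
rewrite cexpectD//; last exact: bounded_measurableD.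
rewrite cexpectD// cexpectZ// cexpect_sum// => /eqP; rewrite subr_eq0 => /eqP.
move=> e.
have -> : rmsum la (fun m la' => m%:R * trace_moment ((k + m)%N :: la') nu) =
    cexpect mu (fun U => rmsum la (fun m la' =>
      m%:R * (ptraces ((k + m)%N :: la') U * (ptraces nu U)^*))).
  rewrite /rmsum cexpect_sum => [|i]; last exact: bounded_measurableZ.
  by apply: eq_bigr => i _; rewrite cexpectZ.
rewrite [LHS]e /rmsum cexpect_sum => [|i]; last exact: bounded_measurableZ.
apply: eq_bigr => i _; rewrite cexpectZ//; congr (_ * _).
by case: ltngtP => _ //; rewrite cexpectZ.
Qed.

Lemma trace_moment_conj la nu : trace_moment la nu = (trace_moment nu la)^*.
Proof.
have bP := @bounded_measurable_ptraces R N.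
rewrite /trace_moment -cexpect_conj; last first.
  by apply: bounded_measurableM => //; exact: bounded_measurable_conj.
by congr cexpect; apply/funext => U; rewrite rmorphM /= conjCK mulrC.
Qed.

(** The exact Gaussian moments of traces, due to Diaconis and Shahshahani, in the range where the
    loop equations determine them. *)
Lemma trace_moment_wick la nu : all (ltn 0) la -> all (ltn 0) nu ->
  (sumn la <= N)%N -> (sumn nu <= N)%N -> trace_moment la nu = wick C la nu.
Proof.
apply: (loop_eq_unique loop_eq_trace_moment (@loop_eq_wick C N)).
- rewrite /trace_moment -[RHS](cexpect_cst mu); congr cexpect.
  by apply/funext => U; rewrite /ptraces !big_nil rmorph1 mulr1.
- exact: trace_moment_conj.
- move=> s t; rewrite -[LHS](wick_sym C t s); apply/esym/conj_Creal/ger0_real.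
  exact: wick_ge0.
Qed.

(** * Moments of linear combinations of traces *)

Definition trace_poly M (a : nat -> C) (U : T) : C :=
  \sum_(1 <= k < M.+1) a k * ptrace k U.

Lemma bounded_measurable_seqsum M K (f : seq nat -> T -> C) :
  (forall s, bounded_measurable (f s)) ->
  bounded_measurable (fun U => seqsum M K (f^~ U)).
Proof.
elim: K f => [|K IH] f bf; first exact: bf.
by apply: bounded_measurable_sum => k; apply: (IH (fun s => f (k :: s))).
Qed.

Lemma cexpect_seqsum M K (f : seq nat -> T -> C) :
  (forall s, bounded_measurable (f s)) ->
  cexpect mu (fun U => seqsum M K (f^~ U)) = seqsum M K (fun s => cexpect mu (f s)).
Proof.
elim: K f => [|K IH] f bf //=; rewrite cexpect_sum => [|k]; last first.
  exact: (bounded_measurable_seqsum M K (f := fun s => f (k :: s))).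
by apply: eq_bigr => k _; rewrite (IH (fun s => f (k :: s))).
Qed.

(** The expansion runs over pairs of lists of sum at most K M <= N, so every trace moment in it is a
    [wick] value. These are nonnegative and the coefficients have modulus at most 1, so the sum is
    at most its value when all a k = 1. *)
Lemma trace_poly_moment M K (a : nat -> C) : (K * M <= N)%N ->
  (forall k, `|a k| <= 1) ->
  bounded_measurable (fun U : T => `|trace_poly M a U| ^+ (2 * K)) /\
  `|cexpect mu (fun U => `|trace_poly M a U| ^+ (2 * K))| <= K`!%:R * M%:R ^+ (2 * K).
Proof.
move=> KMN a1.
pose g la nu (U : T) := \prod_(k <- la) a k * (\prod_(k <- nu) a k)^* *
   (ptraces la U * (ptraces nu U)^*).
have bg la nu : bounded_measurable (g la nu).
  apply/bounded_measurableZ/bounded_measurableM; last apply: bounded_measurable_conj.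
    exact: bounded_measurable_ptraces.
  exact: bounded_measurable_ptraces.
have -> : (fun U : T => `|trace_poly M a U| ^+ (2 * K)) =
    (fun U => seqsum M K (fun la => seqsum M K (fun nu => g la nu U))).
  apply/funext => U.
  have conjS (f : seq nat -> C) : (seqsum M K f)^* = seqsum M K (fun s => (f s)^*).
    elim: K f {KMN} => //= K IH f; rewrite rmorph_sum.
    by apply: eq_bigr => k _; rewrite /= IH.
  rewrite exprM normCK exprMn -rmorphXn /= expr_seqsum conjS mulrC mulr_seqsumr.
  apply: eq_seqsum => la _ _; rewrite mulrC mulr_seqsumr.
  apply: eq_seqsum => nu _ _; rewrite /g /ptraces !big_split !rmorphM /=; ring.
have b1 la : bounded_measurable (fun U => seqsum M K (fun nu => g la nu U)).
  exact: bounded_measurable_seqsum.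
split; first exact: bounded_measurable_seqsum.
rewrite (cexpect_seqsum M K (f := fun la U => seqsum M K (fun nu => g la nu U)))//.
apply: le_trans (seqsum_wick_le C M K).
apply: le_trans (ler_norm_seqsum _ _ _) _.
have small s : size s = K -> all (fun k => 0 < k <= M)%N s ->
    all (ltn 0) s /\ (sumn s <= N)%N.
  move=> sK sM; split; first by apply: sub_all sM => k /andP[].
  apply: leq_trans KMN; rewrite -{}sK.
  by elim: s sM => //= k s IH /andP[/andP[_ kM] /IH]; rewrite mulSn; exact: leq_add.
apply: ler_seqsum => la laK laM; rewrite cexpect_seqsum//.
apply: le_trans (ler_norm_seqsum _ _ _) _.
apply: ler_seqsum => nu nuK nuM.
have [la0 laN] := small _ laK laM; have [nu0 nuN] := small _ nuK nuM.
have -> : cexpect mu (g la nu) = \prod_(k <- la) a k * (\prod_(k <- nu) a k)^* *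
    wick C la nu.
  rewrite -trace_moment_wick// /trace_moment -cexpectZ//.
  apply: bounded_measurableM; last apply: bounded_measurable_conj.
    exact: bounded_measurable_ptraces.
  exact: bounded_measurable_ptraces.
have prod1 s : `|\prod_(k <- s) a k| <= 1.
  rewrite normr_prod; elim: s => [|k s IH]; first by rewrite big_nil.
  by rewrite big_cons mulr_ile1 ?prodr_ge0.
rewrite !normrM norm_conjC (ger0_norm (wick_ge0 _ _ _)) ler_piMl ?wick_ge0//.
by rewrite mulr_ile1.
Qed.

End LoopEquation.

(** * Spectral theorem and traces of powers *)

Lemma char_poly_conj (F : comUnitRingType) n (P D : 'M[F]_n) : P \in unitmx ->
  char_poly (invmx P *m D *m P) = char_poly D.
Proof.
move=> Pu; pose Q := map_mx polyC P; pose Q' := map_mx polyC (invmx P).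
have Q'Q : Q' *m Q = 1%:M by rewrite -map_mxM mulVmx// map_mx1.
rewrite /char_poly.
have -> : char_poly_mx (invmx P *m D *m P) = Q' *m char_poly_mx D *m Q.
  rewrite /char_poly_mx mulmxBr mulmxBl !map_mxM -/Q -/Q'; congr (_ - _).
  by rewrite scalar_mxC -mulmxA Q'Q mulmx1.
rewrite !det_mulmx mulrC mulrA -det_mulmx.
by rewrite (mulmx1C Q'Q) det1 mul1r.
Qed.

Lemma unitary_normalmx (C : numClosedFieldType) n (A : 'M[C]_n) :
  A \is unitarymx -> A \is normalmx.
Proof.
move=> /unitarymxP AA; apply/normalmxP; rewrite AA.
by rewrite (mulmx1C AA).
Qed.

(** The roots r j come in an arbitrary order; they agree with the spectral diagonal as a multiset
    because both factor the characteristic polynomial. *)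
Lemma normal_mxtraceX (C : numClosedFieldType) n (A : 'M[C]_n) (r : 'I_n -> C) k :
  A \is normalmx -> char_poly A = \prod_j ('X - (r j)%:P) ->
  \tr (A ^+ k) = \sum_j r j ^+ k.
Proof.
move=> /orthomx_spectralP; set P := spectralmx A; set d := spectral_diag A => AE Ar.
have Pu : P \in unitmx by exact: spectral_unit.
have AX : A ^+ k = invmx P *m diag_mx (\row_j d 0 j ^+ k) *m P.
  elim: k => [|k IH].
    rewrite expr0 (_ : diag_mx _ = 1%:M) ?mulmx1 ?mulVmx//.
    by apply/matrixP => i j; rewrite !mxE expr0.
  rewrite exprS -mulmxE IH {1}AE -!mulmxA (mulmxA P) mulmxV// mul1mx.
  rewrite (mulmxA (diag_mx d)) mulmx_diag; congr (_ *m (diag_mx _ *m _)).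
  by apply/rowP => j; rewrite !mxE exprS.
rewrite AX mxtrace_mulC mulmxA mulmxV// mul1mx mxtrace_diag.
have pe : perm_eq [seq d 0 j | j <- index_enum 'I_n] [seq r j | j <- index_enum 'I_n].
  apply: prod_XsubC_eq; rewrite !big_map -Ar AE char_poly_conj//.
  rewrite char_poly_trig ?diag_mx_is_trig//.
  by apply: eq_bigr => i _; rewrite mxE eqxx mulr1n.
transitivity (\sum_(x <- [seq d 0 j | j <- index_enum 'I_n]) x ^+ k).
  by rewrite big_map; apply: eq_bigr => j _; rewrite mxE.
by rewrite (perm_big _ pe) big_map.
Qed.

Section Eigenvalues.
Variables (R : realType) (N : nat).
Local Notation C := (cplx R).
Local Notation T := (unitary_borel R N).

Lemma ptrace_eigval k (U : T) : ptrace k U = \sum_(j < N) (eigval (umx U) j : C) ^+ k.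
Proof.
apply: normal_mxtraceX; first exact/unitary_normalmx/umx_unitary.
by have [_] := eigenangleP U.
Qed.

Lemma logderiv_sum (U : unitary R N) (z : C) : (forall j, z <> eigval (umx U) j) ->
  logderiv (umx U) z = \sum_(j < N) 1 / (z - eigval (umx U) j).
Proof.
move=> zU; rewrite /logderiv; have [_ ->] := eigenangleP U.
have : all (fun j => z - eigval (umx U) j != 0) (index_enum 'I_N).
  by apply/allP => j _; rewrite subr_eq0; apply/eqP.
elim: (index_enum _) => [|j s IH]; first by rewrite !big_nil -polyC1 derivC horner0 mul0r.
rewrite /= => /andP[zj zs]; rewrite !big_cons -IH// derivM derivXsubC mul1r.
have sz : (\prod_(j <- s) ('X - (expi (eigenangle (umx U) j))%:P)).[z] != 0.
  rewrite horner_prod prodf_seq_neq0; apply: sub_all zs => i.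
  by rewrite hornerXsubC.
rewrite !hornerE -/(eigval _ j); field.
by rewrite sz zj.
Qed.

End Eigenvalues.

(** * Pointwise bound for the error term *)

Section SineBounds.
Local Open Scope complex_scope.
Variable R : realType.
Implicit Types x t : R.

Lemma sin_MVT x : 0 <= x -> exists2 y, 0 <= y <= x & sin x = cos y * x.
Proof.
move=> x0; have := @MVT_segment R sin cos 0 x x0.
case=> [|y].
  exact/continuous_subspaceT/continuous_sin.
by rewrite in_itv /= sin0 !subr0 => y0x ->; exists y.
Qed.

Lemma ler_sin_id x : 0 <= x -> sin x <= x.
Proof.
by move=> x0; have [y _ ->] := sin_MVT x0; rewrite ler_piMl ?cos_le1.
Qed.

(** cos (2 x) >= 0 gives cos x >= (cos x)^2 >= 1/2. *)
Lemma cos_ge_half x : 0 <= x <= pi / 4 -> 1 / 2 <= cos x.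
Proof.
move=> /andP[x0 x4].
have c0 : 0 <= cos x.
  apply: cos_ge0_pihalf; have := pi_ge0 R; lra.
have : 0 <= cos (x *+ 2).
  apply: cos_ge0_pihalf; have := pi_ge0 R; lra.
rewrite cos_mulr2n => c2.
have := cos_le1 x; nra.
Qed.

Lemma ler_half_sin x : 0 <= x <= pi / 4 -> x / 2 <= sin x.
Proof.
move=> /andP[x0 x4]; have [y /andP[y0 yx] ->] := sin_MVT x0.
have := @cos_ge_half y; rewrite y0 (le_trans yx x4) => /(_ isT); nra.
Qed.

Lemma sqr_normc (w : R[i]) : Normc.normc w ^+ 2 = complex.Re w ^+ 2 + complex.Im w ^+ 2.
Proof. by case: w => a b /=; rewrite sqr_sqrtr ?addr_ge0 ?sqr_ge0. Qed.

Lemma normc_ge0 (w : R[i]) : 0 <= Normc.normc w.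
Proof. by case: w => a b /=; rewrite sqrtr_ge0. Qed.

Lemma normc_expi t : Normc.normc (expi t) = 1.
Proof. by rewrite /= cos2Dsin2 sqrtr1. Qed.

(** Only the square of the chord is computed, by half-angle formulas, so the sign of the sine stays
    open here. *)
Lemma normc_chord t : Normc.normc (1 - expi t) = 2 * sin (`|t| / 2) \/
  Normc.normc (1 - expi t) = - (2 * sin (`|t| / 2)).
Proof.
set s := sin _.
have : Normc.normc (1 - expi t) ^+ 2 = (2 * s) ^+ 2.
  rewrite sqr_normc /= sub0r sqrrN.
  have -> : cos t = 1 - 2 * s ^+ 2.
    rewrite -cos_norm [`|t|]splitr -mulr2n cos_mulr2n cos2sin2 -/s -[_ *+ 2]mulr_natl; ring.
  have -> : sin t ^+ 2 = 1 - (1 - 2 * s ^+ 2) ^+ 2.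
    rewrite sin2cos2; congr (1 - _ ^+ 2).
    rewrite -cos_norm [`|t|]splitr -mulr2n cos_mulr2n cos2sin2 -/s -[_ *+ 2]mulr_natl; ring.
  ring.
by move/eqP; rewrite eqf_sqr => /orP[/eqP|/eqP]; [left|right].
Qed.

(** The chord is 4 sin(|t|/4) cos(|t|/4) with |t|/4 <= pi/4, the range where the cosine is at least
    1/2 and the sine at least half its argument. *)
Lemma chord_bounds t : `|t| <= pi ->
  `|t| / 4 <= Normc.normc (1 - expi t) <= `|t|.
Proof.
move=> tpi; have t0 := normr_ge0 t; set a := `|t| in tpi t0 *.
have : a / 8 <= sin (a / 4) by have := @ler_half_sin (a / 4); lra.
have c4 : 1 / 2 <= cos (a / 4) by apply: cos_ge_half; lra.
have s2 : sin (a / 2) = 2 * (cos (a / 4) * sin (a / 4)).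
  by rewrite mulr_natl -sin_mulr2n -mulr_natl; congr sin; lra.
have := @ler_sin_id (a / 2).
have := normc_ge0 (1 - expi t).
case: (normc_chord t) => ->; rewrite -/a => d0 sle s8; apply/andP; split; nra.
Qed.

End SineBounds.

(** * Cesaro means of the geometric series and the positive kernel *)

Lemma geometric_sum (F : comPzRingType) (u : F) M :
  (1 - u) * \sum_(k < M) u ^+ k = 1 - u ^+ M.
Proof.
elim: M => [|M IH]; first by rewrite big_ord0 mulr0 expr0 subrr.
by rewrite big_ord_recr /= mulrDr IH exprS; ring.
Qed.

Lemma fejer_sum (F : comPzRingType) (u : F) M :
  (1 - u) ^+ 2 * \sum_(k < M) (M - k)%:R * u ^+ k =
  M%:R * (1 - u) - u * (1 - u ^+ M).
Proof.
elim: M => [|M IH]; first by rewrite big_ord0 expr0; ring.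
have -> : \sum_(k < M.+1) (M.+1 - k)%:R * u ^+ k =
    \sum_(k < M) (M - k)%:R * u ^+ k + \sum_(k < M.+1) u ^+ k.
  rewrite [RHS]addrC big_ord_recr [in RHS]big_ord_recr /= subSnn mul1r.
  rewrite -addrA [_ + \sum_(k < M) _]addrC addrA -big_split /=; congr (_ + _).
  apply: eq_bigr => k _; rewrite subSn 1?ltnW// -natr1; ring.
rewrite mulrDr IH expr2 -mulrA geometric_sum exprS -natr1; ring.
Qed.

Definition cesaro (F : fieldType) M (u : F) : F :=
  \sum_(k < M) (M - k)%:R / M%:R * u ^+ k.

(** A plain partial sum errs by u^M / (1 - u); averaging the first M of them turns this into a decay
    like 1/(M (1 - u)^2), which a Fejer-type kernel can dominate. *)
Lemma cesaro_error (F : numFieldType) M (u : F) : (0 < M)%N -> u != 1 ->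
  1 / (1 - u) - cesaro M u = u * (1 - u ^+ M) / (M%:R * (1 - u) ^+ 2).
Proof.
move=> M0 u1; have u0 : 1 - u != 0 by rewrite subr_eq0 eq_sym.
have Mn : M%:R != 0 :> F by rewrite pnatr_eq0 -lt0n.
have -> : cesaro M u = M%:R^-1 * \sum_(k < M) (M - k)%:R * u ^+ k.
  by rewrite mulr_sumr; apply: eq_bigr => k _; rewrite mulrA [in RHS]mulrC; ring.
apply: (mulfI (mulf_neq0 Mn (expf_neq0 2 u0))).
rewrite mulrBr mulrA [X in _ - X](_ : _ = (1 - u) ^+ 2 * \sum_(k < M) (M - k)%:R * u ^+ k).
  by rewrite fejer_sum; field; rewrite u0 Mn.
by field.
Qed.

Section Kernel.
Local Open Scope complex_scope.
Variable R : realType.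
Implicit Types (u w : R[i]).
Local Notation normc := (@Normc.normc R).

Lemma norm_normc u : `|u| = (normc u)%:C.
Proof. by []. Qed.

Lemma ler_normc_cesaro M u : (0 < M)%N -> normc u <= 1 -> normc (cesaro M u) <= M%:R.
Proof.
move=> M0 u1; rewrite -lecR -norm_normc rmorph_nat.
have {}u1 : `|u| <= 1 by rewrite norm_normc -(rmorph1 (real_complex R)) lecR.
apply: le_trans (ler_norm_sum _ _ _) _.
rewrite -[leRHS]mul1r -[in leRHS](card_ord M) mulr_natr -sumr_const.
apply: ler_sum => k _; rewrite normrM normrX mulr_ile1 ?exprn_ile1 ?normr_ge0 ?exprn_ge0//.
rewrite ger0_norm ?divr_ge0// ler_pdivrMr ?ltr0n// mul1r ler_nat leq_subr//.
Qed.

Lemma ler_cesaro_error M u : (0 < M)%N -> normc u <= 1 -> u != 1 ->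
  normc (1 / (1 - u) - cesaro M u) <= 2 / (M%:R * normc (1 - u) ^+ 2).
Proof.
move=> M0 u1 un1; rewrite -lecR -norm_normc cesaro_error//.
rewrite fmorph_div rmorphM rmorphXn !rmorph_nat /= -norm_normc.
have {}u1 : `|u| <= 1 by rewrite norm_normc -(rmorph1 (real_complex R)) lecR.
rewrite normf_div [`|M%:R * _|]normrM normr_nat normrX ler_wpM2r//.
rewrite normrM; apply: le_trans (ler_piMl _ u1) _ => //.
apply: le_trans (ler_normB _ _) _; rewrite normr1 normrX.
by rewrite -[2]/(1 + 1) lerD2l exprn_ile1.
Qed.

(** The right side is the Poisson kernel. *)
Lemma normc_inv_Re u : u != 1 ->
  2 * complex.Re (1 / (1 - u)) - 1 = (1 - normc u ^+ 2) / normc (1 - u) ^+ 2.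
Proof.
move=> u1; rewrite !sqr_normc; case: u u1 => a b /=.
rewrite eq_complex /= negb_and => ab.
have d : (1 - a) ^+ 2 + (0 - b) ^+ 2 != 0.
  by rewrite paddr_eq0 ?sqr_ge0// !sqrf_eq0 sub0r oppr_eq0 subr_eq0 eq_sym negb_and.
set D := _ + _ in d *; rewrite mul0r subr0 mul1r.
transitivity ((2 * (1 - a) - D) / D); first by field.
by congr (_ / _); rewrite /D; ring.
Qed.

Lemma ler_Re_normc u : - normc u <= complex.Re u <= normc u.
Proof.
case: u => a b /=; rewrite -ler_norml -sqrtr_sqr ler_sqrt ?lerDl ?sqr_ge0//.
by rewrite addr_ge0 ?sqr_ge0.
Qed.

(* The Fejer kernel smoothed by a Poisson kernel of radius [1 - 8 / M]: at this
   radius the main term beats the truncation error, so no zeros remain. *)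
Definition fejer_poisson M w : R :=
  2 * complex.Re (cesaro M ((1 - 8 / M%:R)%:C * w)) - 1.

(** With r = 1 - 8/M and e = |1 - r w|, the Poisson kernel is at least (1 - r)/e^2 = 8/(M e^2),
    while truncating to the Cesaro mean loses at most 4/(M e^2). What remains is 4/(M e^2), and e <=
    |1 - w| + 8/M. *)
Lemma fejer_poisson_ge M w : (8 <= M)%N -> normc w = 1 ->
  4 * M%:R / (M%:R * normc (1 - w) + 8) ^+ 2 <= fejer_poisson M w.
Proof.
move=> M8 w1; rewrite /fejer_poisson; set m : R := M%:R; set r := 1 - 8 / m.
set u := r%:C * w; set d := normc (1 - w).
have m8 : 8 <= m by rewrite (ler_nat _ 8).
have m0 : 0 < m by lra.
have r01 : 0 <= r < 1.
  by rewrite /r subr_ge0 ler_pdivrMr// mul1r m8/= ltrBlDr ltrDl divr_gt0//; lra.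
have [r0 r1] := andP r01.
have nr : normc r%:C = r by rewrite /= expr0n addr0 sqrtr_sqr ger0_norm.
have nu : normc u = r by rewrite /u Normc.normcM nr w1 mulr1.
have un1 : u != 1.
  by apply: contraTneq r1 => u1; rewrite -nu u1 Normc.normc1 ltxx.
have d0 : 0 <= d by exact: normc_ge0.
set e := normc (1 - u).
have e0 : 0 < e.
  rewrite lt_neqAle normc_ge0 andbT eq_sym.
  by apply: contra un1 => /eqP/Normc.eq0_normc/eqP; rewrite subr_eq0 eq_sym.
have ed : e <= d + 8 / m.
  have -> : e = normc ((1 - w) + (1 - r)%:C * w).
    have rB : (1 - r)%:C = 1 - r%:C :> R[i] by exact: (rmorphB (real_complex R) 1 r).
    by rewrite /e /u rB; congr normc; ring.
  apply: le_trans (le_normcD _ _) _; rewrite lerD2l Normc.normcM w1 mulr1.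
  have r1' : 0 <= 1 - r by lra.
  by rewrite /= expr0n addr0 sqrtr_sqr ger0_norm// /r; lra.
have err : normc (1 / (1 - u) - cesaro M u) <= 2 / (m * e ^+ 2).
  by apply: ler_cesaro_error => //; [lia|rewrite nu ltW].
have := normc_inv_Re un1; rewrite nu -/e => main.
have := ler_Re_normc (1 / (1 - u) - cesaro M u); rewrite raddfB /= => /andP[_ Re_le].
have lb : 4 / (m * e ^+ 2) <= 2 * complex.Re (cesaro M u) - 1.
  have : 8 / (m * e ^+ 2) <= (1 - r ^+ 2) / e ^+ 2.
    rewrite invfM mulrA ler_pM2r ?invr_gt0 ?exprn_gt0//.
    have : 8 / m = 1 - r by rewrite /r opprB addrC subrK.
    nra.
  lra.
apply: le_trans lb.
rewrite ler_pdivrMr; last by rewrite exprn_gt0//; nra.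
rewrite mulrAC ler_pdivlMr; last by rewrite mulr_gt0// exprn_gt0.
have me : m * e <= m * d + 8.
  have -> : m * d + 8 = m * (d + 8 / m) by field; rewrite gt_eqF.
  by rewrite ler_pM2l.
rewrite -!mulrA ler_pM2l ?ltr0n//.
have -> : m * (m * e ^+ 2) = (m * e) ^+ 2 by ring.
by rewrite lerXn2r// nnegrE; nra.
Qed.

End Kernel.

(** * Approximation of a single term *)

Section PointwiseBound.
Variable R : realType.
Local Notation C := (cplx R).
Local Notation normc := (@Normc.normc R).

(** The radial gap 1 - z is itself at most |z - w|, because |w| = 1. *)
Lemma chord_le_dist (t z : R) : 0 <= z <= 1 ->
  normc (1 - expi t) <= 2 * normc (z%:C%C - expi t).
Proof.
move=> /andP[z0 z1]; set w := expi t; set e := normc (z%:C%C - w).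
have -> : 1 - w = (1 - z)%:C%C + (z%:C%C - w).
  by rewrite (rmorphB (real_complex R) 1 z) rmorph1 addrA subrK.
apply: le_trans (le_normcD _ _) _.
have -> : normc (1 - z)%:C%C = 1 - z.
  by rewrite /= expr0n addr0 sqrtr_sqr ger0_norm// subr_ge0.
have : normc w <= normc (w - z%:C%C) + normc z%:C%C.
  by rewrite -{1}[w](subrK z%:C%C); exact: le_normcD.
have -> : normc (w - z%:C%C) = e by rewrite /e -opprB normcN.
have -> : normc z%:C%C = z by rewrite /= expr0n addr0 sqrtr_sqr ger0_norm.
rewrite normc_expi -/e; lra.
Qed.

(** With u = z conj w, 1/(z - w) = - conj w / (1 - u), hence the plus sign before the Cesaro mean.
    Where M d <= 1 both summands are bounded crudely, by 8 N/c and M; where M d > 1 the cutoff is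
    inactive and the Cesaro error is compared with the kernel. *)
Lemma resolvent_approx M N (c z t : R) : (8 <= M <= N)%N -> 0 < c <= 1 ->
  0 <= z <= 1 -> `|t| <= pi ->
  normc ((if c / N%:R <= `|t| then 1 / (z%:C%C - expi t) else 0)
    + (expi t : C)^* * cesaro M (z%:C%C * (expi t : C)^*)) <=
  183 * (N%:R / c / M%:R) * fejer_poisson M (expi t).
Proof.
move=> /andP[M8 MN] /andP[c0 c1] /andP[z0 z1] tpi.
have wn1 := normc_expi t.
have H := fejer_poisson_ge M8 wn1.
have /andP[td dt] := chord_bounds tpi.
set w : C := expi t in wn1 H td dt *.
set d := normc (1 - w) in H td dt.
have d0 : 0 <= d by exact: normc_ge0.
set m : R := M%:R in H *; set n : R := N%:R; set h := fejer_poisson M w in H *.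
have m8 : 8 <= m by rewrite (ler_nat _ 8).
have mn : m <= n by rewrite ler_nat.
have m0 : 0 < m by lra.
have n0 : 0 < n by lra.
set x := n / c; have xm : m <= x by rewrite /x ler_pdivlMr//; nra.
have h0 : 0 <= h.
  by apply: le_trans H; rewrite divr_ge0 ?sqr_ge0//; lra.
have md0 : 0 <= m * d by rewrite mulr_ge0// ltW.
have m40 : 0 < 4 * m by lra.
have h_small : m * d <= 1 -> 4 * m / 81 <= h.
  move=> md1; apply: le_trans H; rewrite ler_pM2l//.
  move: (m * d) md0 md1 => y y0 y1.
  by rewrite lef_pV2 ?posrE; nra.
set u : C := z%:C%C * w^*.
have ww : w * w^* = 1 by rewrite -normCK norm_normc wn1 rmorph1 expr1n.
have nwC : normc w^* = 1 by apply: complexI; rewrite -norm_normc norm_conjC norm_normc wn1.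
have nz : normc z%:C%C = z by rewrite /= expr0n addr0 sqrtr_sqr ger0_norm.
have nu : normc u = z by rewrite /u Normc.normcM nwC mulr1.
have M0 : (0 < M)%N by apply: leq_trans M8.
have u1 : normc u <= 1 by rewrite nu.
have ces : normc (cesaro M u) <= m by exact: (@ler_normc_cesaro R M u M0 u1).
have nces : normc (w^* * cesaro M u) <= m by rewrite Normc.normcM nwC mul1r.
have xE : x / m * m = x by rewrite divfK// gt_eqF.
(* The constant 183 is the least integer above 9 * 81 / 4, where 81 is the square of the bound 9 for
   m d + 8. *)
have bound9 : m * d <= 1 -> 9 * x <= 183 * (x / m) * h.
  move=> /h_small; rewrite -[X in 9 * X]xE.
  have : 0 < x / m by rewrite divr_gt0// (lt_le_trans m0).
  by move: (x / m) => y; nra.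
have [tc|tc] := leP (c / n) `|t|; last first.
  rewrite add0r; apply: le_trans nces _; apply: le_trans (bound9 _); first lra.
  have dc : d <= c / n by exact: le_trans dt (ltW tc).
  have : d * n <= c by rewrite -ler_pdivlMr.
  nra.
set e := normc (z%:C%C - w).
have de : d <= 2 * e by apply: chord_le_dist; rewrite z0.
have cn : c / n = x^-1 by rewrite /x invf_div.
have x0 : 0 < x by lra.
have xV : 0 < x^-1 by rewrite invr_gt0.
have e0 : 0 < e by rewrite cn in tc; lra.
have wu : z%:C%C - w = - w * (1 - u).
  by rewrite mulrBr mulr1 /u mulrCA !mulNr ww mulrN mulr1 opprK addrC.
have u1e : normc (1 - u) = e.
  by rewrite /e wu Normc.normcM normcN wn1 mul1r.
have un1 : u != 1.
  by apply: contraTneq e0 => u1'; rewrite -u1e u1' subrr Normc.normc0 ltxx.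
have w0 : w != 0 by apply: contra_eq_neq ww => ->; rewrite mul0r eq_sym oner_neq0.
have -> : 1 / (z%:C%C - w) + w^* * cesaro M u = - w^* * (1 / (1 - u) - cesaro M u).
  have -> : 1 / (z%:C%C - w) = - w^* * (1 / (1 - u)).
    rewrite wu !div1r invfM invrN; congr (- _ * _).
    by apply: (mulfI w0); rewrite divff// ww.
  by rewrite mulrBr !mulNr opprK.
rewrite Normc.normcM normcN nwC mul1r.
have [md|md] := leP (m * d) 1.
  apply: le_trans (bound9 md); apply: le_trans (le_normcD _ _) _.
  rewrite normcN div1r Normc.normcV u1e.
  (* The cutoff gives d >= |t|/4 >= 1/(4 x), and d <= 2 e. *)
  have : e^-1 <= 8 * x.
    rewrite -[e^-1]mul1r ler_pdivrMr//.
    have xx : x * x^-1 = 1 by rewrite divff// gt_eqF.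
    have : x^-1 <= 8 * e by rewrite cn in tc; lra.
    nra.
  lra.
apply: le_trans (@ler_cesaro_error R M u M0 u1 un1) _; rewrite u1e -/m.
have dp : 0 < d by nra.
(* Here m d + 8 <= 9 m d; with the error bound 8/(m d^2) derived below, the ratio is 8 * 81 / 4 =
   162, within 183. *)
have : 4 * m / (81 * (m * d) ^+ 2) <= h.
  apply: le_trans H; rewrite ler_pM2l//.
  move: (m * d) md => y y1.
  by rewrite lef_pV2 ?posrE; nra.
have -> : 4 * m / (81 * (m * d) ^+ 2) = 4 / 81 / (m * d ^+ 2).
  by field; rewrite !gt_eqF.
have de2 : 2 / (m * e ^+ 2) <= 8 / (m * d ^+ 2).
  rewrite ler_pdivrMr ?mulr_gt0 ?exprn_gt0// mulrAC ler_pdivlMr ?mulr_gt0 ?exprn_gt0//.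
  rewrite !mulrA [2 * m]mulrC [8 * m]mulrC -!mulrA ler_pM2l//; nra.
set q := (m * d ^+ 2)^-1 in de2 *.
have q0 : 0 < q by rewrite invr_gt0 mulr_gt0 ?exprn_gt0.
have xm1 : 1 <= x / m by rewrite ler_pdivlMr// mul1r.
move: (x / m) xm1 => y y1 hq; nra.
Qed.

End PointwiseBound.

(** * Summation over the eigenangles *)

Section ErrorTerm.
Variable R : realType.
Local Notation C := (cplx R).
Local Notation normc := (@Normc.normc R).

Lemma ler_normc_sum (I : Type) (r : seq I) (P : pred I) (F : I -> R[i]%C) :
  normc (\sum_(i <- r | P i) F i) <= \sum_(i <- r | P i) normc (F i).
Proof.
elim/big_rec2: _ => [|i x y _ xy]; first by rewrite Normc.normc0.
by apply: le_trans (le_normcD _ _) _; rewrite lerD2l.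
Qed.

Lemma error_termE N (U : 'M[R[i]%C]_N) c z : error_term U c z =
  \sum_(j < N) if c / N%:R <= `|eigenangle U j| then 1 / (z%:C%C - eigval U j) else 0.
Proof. by rewrite /error_term big_mkcond. Qed.

Lemma eigenangle_pi N (U : unitary R N) j : `|eigenangle (umx U) j| <= pi.
Proof.
have [/(_ j)/andP[/ltW a b] _] := eigenangleP U.
by rewrite ler_norml a b.
Qed.

(** The factor conj w shifts the exponents 0, ..., M - 1 to 1, ..., M, so no constant term appears
    and coefficients are read at [k.-1]. *)
Lemma sum_conj_cesaro N M (z : R) (U : unitary_borel R N) :
  \sum_(j < N) (eigval (umx U) j : C)^* * cesaro M (z%:C%C * (eigval (umx U) j : C)^*) =
  (trace_poly M (fun k => (((M - k.-1)%:R / M%:R * z ^+ k.-1)%:C)%C) U)^*.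
Proof.
rewrite /trace_poly big_add1 big_mkord rmorph_sum /=.
under eq_bigr do rewrite mulr_sumr.
rewrite exchange_big /=; apply: eq_bigr => k _.
rewrite ptrace_eigval rmorphM /= (conj_Creal (real_complex_real _)) rmorph_sum mulr_sumr.
apply: eq_bigr => j _; rewrite rmorphXn /= exprMn exprS rmorphM rmorphXn fmorph_div !rmorph_nat.
ring.
Qed.

(** The kernel has constant term 1, which contributes N; only powers from 1 on enter the trace
    polynomial. *)
Lemma sum_fejer_poisson N M (U : unitary_borel R N) : (0 < M)%N ->
  \sum_(j < N) fejer_poisson M (eigval (umx U) j) = N%:R +
  2 * complex.Re (trace_poly M
    (fun k => (((M - k)%:R / M%:R * (1 - 8 / M%:R) ^+ k)%:C)%C) U).
Proof.
move=> M0; set r := 1 - 8 / M%:R.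
have -> : trace_poly M (fun k => (((M - k)%:R / M%:R * r ^+ k)%:C)%C) U =
    \sum_(j < N) cesaro M (r%:C%C * (eigval (umx U) j : C)) - N%:R.
  rewrite /cesaro exchange_big /=.
  rewrite -(big_mkord xpredT (fun k => \sum_(j < N) (M - k)%:R / M%:R *
    (r%:C%C * (eigval (umx U) j : C)) ^+ k)).
  have e0 : \sum_(j < N) (M - 0)%:R / M%:R * (r%:C%C * (eigval (umx U) j : C)) ^+ 0 =
      N%:R.
    under eq_bigr do rewrite expr0 mulr1 subn0 divff ?pnatr_eq0 -?lt0n//.
    by rewrite sumr_const card_ord.
  rewrite big_ltn// e0 addrAC subrr add0r.
  (* The coefficient at k = M is zero; it only extends the range to that of [trace_poly]. *)
  rewrite /trace_poly big_nat_recr//= subnn !mul0r addr0.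
  apply: eq_bigr => k _; rewrite ptrace_eigval mulr_sumr; apply: eq_bigr => j _.
  by rewrite rmorphM rmorphXn fmorph_div !rmorph_nat exprMn mulrA.
rewrite raddfB raddf_sum /= mulrBr mulr_sumr.
have -> : complex.Re (N%:R : C) = N%:R by rewrite -(rmorph_nat (real_complex R)).
rewrite [RHS](_ : _ = \sum_(j < N)
  2 * complex.Re (cesaro M (r%:C%C * eigval (umx U) j)) - N%:R); last by ring.
by rewrite sumrB sumr_const card_ord.
Qed.

(** The constant 732 is 183 * 2 * 2: one factor 2 from N <= 2 K M, the other from the term 2 Re Y in
    the summed kernel. *)
Lemma error_term_bound K N (c z : R) : (0 < K)%N -> (0 < N)%N -> 0 < c <= 1 ->
  0 <= z <= 1 ->
  exists M (a b : nat -> C), [/\ (K * M <= N)%N, forall k, `|a k| <= 1,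
    forall k, `|b k| <= 1 & forall U : unitary_borel R N,
    normc (error_term (umx U) c z) <= 732 * K%:R / c *
      (N%:R + normc (trace_poly M a U) + normc (trace_poly M b U))].
Proof.
move=> K0 N0 /[dup] c01 /andP[c0 c1] /[dup] z01 /andP[z0 z1].
have k1 : 1 <= K%:R :> R by rewrite ler1n.
have n0 : 0 < N%:R :> R by rewrite ltr0n.
have cV : 1 <= c^-1 by rewrite invf_ge1.
have [N8|N8] := ltnP N (8 * K).
  (* For N < 8 K the degree N/K is too small for the kernel. Each of the N terms is at most 8 N/c,
     and one factor N is below 8 K; the trace polynomials are empty. *)
  exists 0%N, (fun=> 0), (fun=> 0); split=> [|k|k|U]; rewrite ?muln0 ?normr0//.
  rewrite /trace_poly !big_geq// Normc.normc0 !addr0 error_termE.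
  apply: le_trans (ler_normc_sum _ _ _) _.
  apply: (@le_trans _ _ (\sum_(j < N) 8 * N%:R / c)); last first.
    rewrite sumr_const card_ord -[leLHS]mulr_natr ler_wpM2r//.
    rewrite ler_wpM2r ?invr_ge0 ?(ltW c0)//.
    have : N%:R <= (8 * K)%:R :> R by rewrite ler_nat ltnW.
    rewrite natrM; lra.
  apply: ler_sum => j _; case: ifPn => tc; last first.
    by rewrite Normc.normc0 divr_ge0 ?mulr_ge0// ltW.
  have xE : c / N%:R * (N%:R / c) = 1 by field; rewrite !gt_eqF.
  have x0 : 0 < N%:R / c by rewrite divr_gt0.
  rewrite -mulrA; move: (N%:R / c) (c / N%:R) xE x0 tc => x y xy x0 tc.
  have /andP[td _] := chord_bounds (eigenangle_pi U j).
  have de := chord_le_dist (eigenangle (umx U) j) z01.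
  rewrite -/(eigval (umx U) j) in td de.
  set e := normc (z%:C%C - eigval (umx U) j) in de *.
  have e0 : 0 < e by nra.
  by rewrite div1r Normc.normcV -/e -[e^-1]mul1r ler_pdivrMr//; nra.
pose M := (N %/ K)%N.
have M8 : (8 <= M)%N by rewrite /M leq_divRL.
have MN : (M <= N)%N by exact: leq_div.
have M0 : (0 < M)%N by apply: leq_trans M8.
pose a k : C := (((M - k.-1)%:R / M%:R * z ^+ k.-1)%:C)%C.
pose b k : C := (((M - k)%:R / M%:R * (1 - 8 / M%:R) ^+ k)%:C)%C.
have m8 : 8 <= M%:R :> R by rewrite (ler_nat _ 8).
have m0 : 0 < M%:R :> R by rewrite ltr0n.
have coef1 k l (r : R) : 0 <= r <= 1 -> `|((((M - l)%:R / M%:R * r ^+ k)%:C)%C : C)| <= 1.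
  move=> /andP[r0 r1].
  have q0 : 0 <= (M - l)%:R / M%:R :> R by rewrite divr_ge0.
  rewrite ger0_norm ?lecR ?mulr_ge0 ?exprn_ge0//.
  by rewrite mulr_ile1 ?exprn_ge0 ?exprn_ile1// ler_pdivrMr// mul1r ler_nat leq_subr.
have r01 : 0 <= (1 - 8 / M%:R : R) <= 1.
  have q1 : 8 / M%:R <= 1 :> R by rewrite ler_pdivrMr// mul1r.
  have q0 : 0 <= 8 / M%:R :> R by apply: divr_ge0; lra.
  by lra.
exists M, a, b; split=> [|k|k|U]; [by rewrite mulnC leq_trunc_div|exact: coef1|exact: coef1|].
set X := trace_poly M a U; set Y := trace_poly M b U.
have nX : normc X^* = normc X.
  by apply: complexI; rewrite -norm_normc norm_conjC norm_normc.
pose F j : C := if c / N%:R <= `|eigenangle (umx U) j|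
  then 1 / (z%:C%C - eigval (umx U) j) else 0.
pose G j : C := (eigval (umx U) j : C)^* * cesaro M (z%:C%C * (eigval (umx U) j : C)^*).
have eE : error_term (umx U) c z = \sum_(j < N) (F j + G j) - X^*.
  have -> : X^* = \sum_(j < N) G j by exact/esym/sum_conj_cesaro.
  by rewrite big_split /= addrK error_termE.
have sumFG : normc (\sum_(j < N) (F j + G j)) <=
    183 * (N%:R / c / M%:R) * (N%:R + 2 * complex.Re Y).
  apply: le_trans (ler_normc_sum _ _ _) _.
  rewrite -sum_fejer_poisson// mulr_sumr; apply: ler_sum => j _.
  by apply: resolvent_approx; rewrite ?M8 ?eigenangle_pi.
have ReY := ler_Re_normc Y.
(* Indeed N < (M + 1) K <= 2 K M, as M >= 1. *)
have NM : N%:R <= 2 * K%:R * M%:R :> R.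
  rewrite -!natrM ler_nat; have := ltn_ceil N K0; rewrite -/M => NK.
  have KM : (K <= K * M)%N by rewrite leq_pmulr.
  apply: leq_trans (ltnW NK) _.
  by rewrite mulSn [(M * K)%N]mulnC -mulnA mul2n -addnn leq_add2r.
have cn0 : c != 0 by rewrite gt_eqF.
set y := K%:R / c; have y1 : 1 <= y by rewrite /y ler_pdivlMr// mul1r; lra.
set x := N%:R / c / M%:R in sumFG.
have x0 : 0 <= x by rewrite /x !divr_ge0// ltW.
have xy : x <= 2 * y.
  by rewrite /x /y mulrAC mulrA ler_wpM2r ?invr_ge0 ?(ltW c0)// ler_pdivrMr.
rewrite eE -(mulrA 732) -/y; apply: le_trans (le_normcD _ _) _; rewrite normcN nX.
have X0 := normc_ge0 X; have Y0 := normc_ge0 Y.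
move: sumFG ReY X0 Y0 (ltW n0) => {eE nX NM}.
move: (normc (\sum_(j < N) _)) (normc X) (normc Y) (complex.Re Y) (N%:R : R).
move=> s p q q' n sxn /andP[_ qq] p0 qp0 nn0.
have step1 : x * (n + 2 * q') <= x * (n + 2 * q) by rewrite ler_wpM2l//; lra.
have step2 : x * (n + 2 * q) <= 2 * y * (n + 2 * q) by rewrite ler_wpM2r//; lra.
have step3 : p <= y * p by rewrite ler_peMl.
have step4 : 0 <= y * n by rewrite mulr_ge0//; lra.
rewrite -mulrA in sxn; lra.
Qed.

End ErrorTerm.

(** * The moment bound *)

Lemma ler_expr_sum3 (R : realDomainType) (a b c : R) n : 0 <= a -> 0 <= b -> 0 <= c ->
  (a + b + c) ^+ n <= 3 ^+ n * (a ^+ n + b ^+ n + c ^+ n).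
Proof.
move=> a0 b0 c0.
have le m : 0 <= m -> a <= m -> b <= m -> c <= m -> (a + b + c) ^+ n <= 3 ^+ n * m ^+ n.
  by move=> m0 am bm cm; rewrite -exprMn; apply: lerXn2r; rewrite ?nnegrE; lra.
have an := exprn_ge0 n a0; have bn := exprn_ge0 n b0; have cn := exprn_ge0 n c0.
have p3 : 0 <= 3 ^+ n :> R by rewrite exprn_ge0.
have fin m : m ^+ n <= a ^+ n + b ^+ n + c ^+ n ->
    3 ^+ n * m ^+ n <= 3 ^+ n * (a ^+ n + b ^+ n + c ^+ n) by move=> ?; rewrite ler_wpM2l.
have [ab|ab] := leP a b; have [bc|bc] := leP b c; have [ac|ac] := leP a c;
  solve [apply: (le_trans (le a a0 _ _ _) (fin a _)); lra
   | apply: (le_trans (le b b0 _ _ _) (fin b _)); lra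
   | apply: (le_trans (le c c0 _ _ _) (fin c _)); lra].
Qed.

Lemma logderiv_near_error (R : realType) N (U : unitary R N) (c z : R) :
  (forall j : 'I_N, z%:C%C <> eigval (umx U) j) ->
  logderiv (umx U) z%:C%C = near_sum (umx U) c z + error_term (umx U) c z.
Proof.
move=> zU; rewrite logderiv_sum// (bigID (fun j => `|eigenangle (umx U) j| < c / N%:R)) /=.
by congr (_ + _); apply: eq_bigl => j; rewrite -leNgt.
Qed.

(** The factor 3 comes from the power of a three-term sum; 1 + 2 K! collects N^(2K) and the two
    trace moments, each at most K! M^(2K) <= K! N^(2K). *)
Lemma expectation_error_term (R : realType) K (c : R) N (z : R)
    (mu : probability (unitary_borel R N) R) :
  (0 < K)%N -> 0 < c <= 1 -> (0 < N)%N -> 0 <= z <= 1 -> is_haar mu ->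
  ('E_mu[(fun U => Normc.normc (error_term (umx U) c z) ^+ (2 * K))%R]
     <= ((3 * (732 * K%:R)) ^+ (2 * K) * (1 + 2 * K`!%:R) * (N%:R / c) ^+ (2 * K))%:E)%E.
Proof.
move=> K0 c01 N0 z01 hmu; have /andP[c0 c1] := c01.
have [M [a [b [KM a1 b1 bound]]]] := error_term_bound K0 N0 c01 z01.
have [bX EX] := trace_poly_moment hmu KM a1.
have [bY EY] := trace_poly_moment hmu KM b1.
set X := (fun U => _) in bX EX; set Y := (fun U => _) in bY EY.
have : 0 <= 732 * K%:R :> R by exact: mulr_ge0 (ler0n _ _) (ler0n _ _).
move: (732 * K%:R) bound => q bound q0.
have qc0 : 0 <= q / c by rewrite divr_ge0// ltW.
have [B BE] : exists B : R, B = (3 * (q / c)) ^+ (2 * K) by eexists.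
have B0 : 0 <= B by rewrite BE exprn_ge0// mulr_ge0.
have bXY : bounded_measurable (fun U => X U + Y U) by exact: bounded_measurableD.
pose n2 : cplx R := N%:R ^+ (2 * K).
have bN : bounded_measurable (fun _ : unitary_borel R N => n2).
  exact: bounded_measurable_cst.
have bNXY := bounded_measurableD bN bXY.
(* [F] is the integrable majorant of the 2K-th power of the error. *)
pose F U : cplx R := B%:C%C * (n2 + (X U + Y U)).
have bF : bounded_measurable F by exact: bounded_measurableZ.
have FE U : F U = (B * (N%:R ^+ (2 * K) + (Normc.normc (trace_poly M a U) ^+ (2 * K) +
    Normc.normc (trace_poly M b U) ^+ (2 * K))))%:C%C.
  by rewrite rmorphM !rmorphD !rmorphXn rmorph_nat.
apply: le_trans (expectation_le_Re mu bF _) _.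
  move=> U; rewrite exprn_ge0 ?normc_ge0//= FE /=.
  apply: (@le_trans _ _ ((q / c * (N%:R + Normc.normc (trace_poly M a U) +
      Normc.normc (trace_poly M b U))) ^+ (2 * K))).
    rewrite lerXn2r ?nnegrE ?normc_ge0// mulr_ge0 ?addr_ge0 ?normc_ge0//.
  have -> : B = (q / c) ^+ (2 * K) * 3 ^+ (2 * K) by rewrite BE mulrC exprMn.
  rewrite exprMn -[leRHS]mulrA ler_wpM2l ?exprn_ge0//.
  by rewrite addrA; apply: ler_expr_sum3; rewrite ?normc_ge0.
rewrite lee_fin; have /andP[_ Re_le] := ler_Re_normc (cexpect mu F).
apply: le_trans Re_le _; rewrite -lecR -norm_normc.
have -> : cexpect mu F = B%:C%C * (n2 + (cexpect mu X + cexpect mu Y)).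
  have E2 := cexpectD mu bX bY; have E1 := cexpectD mu bN bXY.
  have E0 := cexpectZ mu B%:C%C bNXY; have Ec := cexpect_cst mu n2.
  by rewrite E0 E1 E2 Ec.
rewrite normrM.
have BC0 : 0 <= B%:C%C :> cplx R by rewrite (lecR 0).
rewrite (ger0_norm BC0).
have -> : (3 * q) ^+ (2 * K) * (1 + 2 * K`!%:R) * (N%:R / c) ^+ (2 * K) =
    B * ((1 + 2 * K`!%:R) * N%:R ^+ (2 * K)).
  by rewrite BE !exprMn; ring.
rewrite rmorphM ler_wpM2l// rmorphM rmorphD rmorph1 rmorphM !rmorphXn !rmorph_nat.
have MN : (M <= N)%N by apply: leq_trans KM; rewrite leq_pmull.
have KMN : K`!%:R * M%:R ^+ (2 * K) <= K`!%:R * N%:R ^+ (2 * K) :> cplx R.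
  by rewrite ler_wpM2l// lerXn2r ?nnegrE// ler_nat.
apply: le_trans (ler_normD _ _) _; rewrite normrX normr_nat mulrDl mul1r lerD2l.
apply: le_trans (ler_normD _ _) _.
rewrite -mulrA mulr_natl mulr2n.
by apply: lerD; [exact: le_trans EX KMN | exact: le_trans EY KMN].
Qed.

Local Open Scope complex_scope.

Theorem theorem1p1 (R : realType) (K : nat) (hK : (0 < K)%N) :
  exists2 C : R, 0 < C &
    forall (c : R) (N : nat) (z : R) (mu : probability (unitary_borel R N) R),
      0 < c <= 1 -> (0 < N)%N -> 1 - N%:R^-1 <= z <= 1 -> is_haar mu ->
      (forall U : unitary R N, (forall j : 'I_N, z%:C <> eigval (umx U) j) ->
         logderiv (umx U) z%:C
           = near_sum (umx U) c z + error_term (umx U) c z) /\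
      ('E_mu[(fun U => Normc.normc (error_term (umx U) c z) ^+ (2 * K))%R]
         <= (C * (N%:R / c) ^+ (2 * K))%:E)%E.
Proof.
have k0 : 0 < K%:R :> R by rewrite ltr0n.
exists ((3 * (732 * K%:R)) ^+ (2 * K) * (1 + 2 * K`!%:R)).
  have q0 : 0 < 3 * (732 * K%:R) :> R by lra.
  have f0 : 0 < 1 + 2 * K`!%:R :> R by have := ler0n R K`!; lra.
  exact: mulr_gt0 (exprn_gt0 _ q0) f0.
move=> c N z mu c01 N0 /andP[Nz z1] hmu; split=> [U|].
  exact: logderiv_near_error.
apply: expectation_error_term => //; rewrite z1 andbT.
by apply: le_trans Nz; rewrite subr_ge0 invf_le1 ?ltr0n// ler1n.
Qed.
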